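(* Let $n\ge2$ and let $\mathbb{Z}_2$ act on $\mathbb{C}$ by $z\mapsto-z$. Then the generalized braid group $Br(D_n)$ is isomorphic to a subgroup of the orbit braid group $\mathcal{B}_n^{orb}(\mathbb{C},\mathbb{Z}_2)$.
   Context: Orbit braid group: let $G=\mathbb{Z}_2$, $M=\mathbb{C}$ and $F_G(M,n)=\{(y_1,\dots,y_n)\in M^{\times n}\mid G(y_i)\cap G(y_j)=\emptyset \text{ for } i\neq j\}$. For an $n$-tuple $y$ (of points, paths or group elements) and $\sigma\in\Sigma_n$ put $y_\sigma=(y_{\sigma(1)},\dots,y_{\sigma(n)})$; $G^{\times n}$ acts coordinatewise. Base point: ${\bf z}=(1+{\bf i},2+2{\bf i},\dots,n+n{\bf i})$, ${\bf z}^{orb}=\{g{\bf z}_\sigma\mid g\in G^{\times n},\sigma\in\Sigma_n\}$. A path $\alpha:I\to F_G(M,n)$ with $\alpha(0)={\bf z}$, $\alpha(1)\in{\bf z}^{orb}$ determines the orbit braid $\widetilde{c(\alpha)}=\{\widetilde{c(\alpha_1)},\dots,\widetilde{c(\alpha_n)}\}$ (unordered), where $\widetilde{c(\alpha_i)}$ is the collection of the strings $\{(h\alpha_i(s),s)\mid s\in I\}\subset M\times I$, $h\in G$. Orbit braids $\widetilde{c(\alpha)},\widetilde{c(\beta)}$ are equivalent if there are paths $\alpha',\beta'$ in $F_G(M,n)$ with $\widetilde{c(\alpha')}=\widetilde{c(\alpha)}$, $\widetilde{c(\beta')}=\widetilde{c(\beta)}$ and $\alpha'\simeq\beta'$ rel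 $\partial I$. $\mathcal{B}_n^{orb}(M,G)$ is the group of equivalence classes with product $[\widetilde{c(\alpha)}]*[\widetilde{c(\beta)}]=[\widetilde{c(\alpha\circ(g\beta_\sigma))}]$, where $\alpha(0)=\beta(0)={\bf z}$, $\alpha(1)=g{\bf z}_\sigma$ and $\circ$ is concatenation. Equivalently, it is the set of homotopy classes rel $\partial I$ of paths $\alpha$ with $\alpha(0)={\bf z}$, $\alpha(1)\in{\bf z}^{orb}$ under $[\alpha]\bullet[\beta]=[\alpha\circ(g\beta_\sigma)]$. $Br(D_n)$ is the generalized braid group (Artin group) of the finite Coxeter group $D_n$: generators $s,\sigma_1,\dots,\sigma_{n-1}$ and relations $\sigma_i\sigma_{i+1}\sigma_i=\sigma_{i+1}\sigma_i\sigma_{i+1}$; $s\sigma_2s=\sigma_2s\sigma_2$; $s\sigma_i=\sigma_is$ $(i\ne2)$; $\sigma_i\sigma_j=\sigma_j\sigma_i$ $(|i-j|>1)$. *)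

(* Defs.v *)
From HB Require Import structures.
From mathcomp Require Import all_boot all_order all_algebra all_fingroup.
From mathcomp Require Import generic_quotient complex.
From mathcomp Require Import boolp classical_sets functions reals topology.
From mathcomp Require Import normedtype lra.

Set Implicit Arguments.
Unset Strict Implicit.
Unset Printing Implicit Defensive.

Import Order.TTheory GRing.Theory Num.Theory numFieldNormedType.Exports.

Local Open Scope classical_set_scope.
Local Open Scope ring_scope.
Local Open Scope complex_scope.
Local Open Scope quotient_scope.

Section Presentation.
Variable X : choiceType.

(* The letter (x, true) stands for x, and (x, false) for the inverse of x. *)
Definition word := seq (X * bool).

Variable rel : word -> word -> Prop.

Inductive pres_eq : word -> word -> Prop :=
| PresRel u v : rel u v -> pres_eq u v
| PresCancel x b : pres_eq [:: (x, b); (x, ~~ b)] [::]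
| PresCat u u' v v' :
    pres_eq u u' -> pres_eq v v' -> pres_eq (u ++ v) (u' ++ v')
| PresRefl u : pres_eq u u
| PresSym u v : pres_eq u v -> pres_eq v u
| PresTrans u v w : pres_eq u v -> pres_eq v w -> pres_eq u w.

Definition pres_eqb (u v : word) : bool := `[< pres_eq u v >].

Lemma pres_eqb_refl : reflexive pres_eqb.
Proof. by move=> u; apply/asboolP; exact: PresRefl. Qed.

Lemma pres_eqb_sym : symmetric pres_eqb.
Proof. by move=> u v; apply/asboolP/asboolP; exact: PresSym. Qed.

Lemma pres_eqb_trans : transitive pres_eqb.
Proof.
by move=> v u w /asboolP uv /asboolP vw; apply/asboolP; exact: PresTrans vw.
Qed.

Definition pres_equiv := EquivRel _ pres_eqb_refl pres_eqb_sym pres_eqb_trans.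

Definition presented := {eq_quot pres_equiv}.

HB.instance Definition _ := Choice.on presented.

Definition word_inv (u : word) : word := rev [seq (a.1, ~~ a.2) | a <- u].

Lemma word_inv_cons a u : word_inv (a :: u) = word_inv u ++ [:: (a.1, ~~ a.2)].
Proof. by rewrite /word_inv /= rev_cons cats1. Qed.

Lemma word_invK u : word_inv (word_inv u) = u.
Proof.
rewrite /word_inv map_rev revK -map_comp -[RHS]map_id.
by apply: eq_map => -[x b] /=; rewrite negbK.
Qed.

Lemma pres_mulV u : pres_eq (u ++ word_inv u) [::].
Proof.
elim: u => [|[x b] u IHu]; first exact: PresRefl.
rewrite word_inv_cons /= -cat1s.
apply: PresTrans (PresCancel x b).
rewrite -[X in pres_eq _ X](cat1s (x, b) [:: (x, ~~ b)]).
apply: PresCat (PresRefl _) _; rewrite catA.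
exact: (PresCat IHu (PresRefl _)).
Qed.

Lemma pres_mulVr u : pres_eq (word_inv u ++ u) [::].
Proof. by have := pres_mulV (word_inv u); rewrite word_invK. Qed.

Lemma pres_inv u v : pres_eq u v -> pres_eq (word_inv u) (word_inv v).
Proof.
move=> uv.
apply: (@PresTrans _ (word_inv u ++ (v ++ word_inv v))).
  rewrite -{1}[word_inv u]cats0.
  by apply: PresCat (PresRefl _) (PresSym (pres_mulV _)).
rewrite catA -{2}[word_inv v]cat0s; apply: PresCat (PresRefl _).
apply: PresTrans (pres_mulVr u).
by apply: PresCat (PresRefl _) (PresSym uv).
Qed.

Definition pres_one : presented := \pi_presented [::].
Definition pres_mul (x y : presented) : presented :=
  \pi_presented (repr x ++ repr y).
Definition pres_invg (x : presented) : presented :=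
  \pi_presented (word_inv (repr x)).

Lemma pres_piP u v : \pi_presented u = \pi_presented v <-> pres_eq u v.
Proof. by split=> [/eqmodP/asboolP|?] //; apply/eqmodP/asboolP. Qed.

Lemma pres_repr u : pres_eq (repr (\pi_presented u)) u.
Proof. by apply/pres_piP; rewrite reprK. Qed.

Lemma pres_mulE u v :
  pres_mul (\pi_presented u) (\pi_presented v) = \pi_presented (u ++ v).
Proof. by apply/pres_piP; apply: PresCat; exact: pres_repr. Qed.

Lemma pres_invE u : pres_invg (\pi_presented u) = \pi_presented (word_inv u).
Proof. by apply/pres_piP/pres_inv/pres_repr. Qed.

Lemma pres_ind (P : presented -> Prop) :
  (forall u, P (\pi_presented u)) -> forall x, P x.
Proof. by move=> Pu x; rewrite -[x]reprK; exact: Pu. Qed.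

Lemma pres_mulA : associative pres_mul.
Proof.
by elim/pres_ind=> u; elim/pres_ind=> v; elim/pres_ind=> w;
  rewrite !pres_mulE catA.
Qed.

Lemma pres_mul1 : left_id pres_one pres_mul.
Proof. by elim/pres_ind=> u; rewrite pres_mulE. Qed.

Lemma pres_mulr1 : right_id pres_one pres_mul.
Proof. by elim/pres_ind=> u; rewrite pres_mulE cats0. Qed.

Lemma pres_mulVg : left_inverse pres_one pres_invg pres_mul.
Proof.
by elim/pres_ind=> u; rewrite pres_invE pres_mulE; apply/pres_piP/pres_mulVr.
Qed.

Lemma pres_mulgV : right_inverse pres_one pres_invg pres_mul.
Proof.
by elim/pres_ind=> u; rewrite pres_invE pres_mulE; apply/pres_piP/pres_mulV.
Qed.

HB.instance Definition _ := isGroup.Build presented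
  pres_mulA pres_mul1 pres_mulr1 pres_mulVg pres_mulgV.

End Presentation.

Section ArtinD.
Variable n : nat.

(* None is the generator s, and Some i is sigma_(i+1). *)
Definition brD_gen := option 'I_n.-1.

Definition brD_s : word brD_gen := [:: (None, true)].
Definition brD_sigma (i : 'I_n.-1) : word brD_gen := [:: (Some i, true)].

Inductive brD_rel : word brD_gen -> word brD_gen -> Prop :=
| BrDBraid (i j : 'I_n.-1) : j = i.+1 :> nat ->
    brD_rel (brD_sigma i ++ brD_sigma j ++ brD_sigma i)
            (brD_sigma j ++ brD_sigma i ++ brD_sigma j)
| BrDBraidS (i : 'I_n.-1) : i.+1 = 2%N ->
    brD_rel (brD_s ++ brD_sigma i ++ brD_s)
            (brD_sigma i ++ brD_s ++ brD_sigma i)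
| BrDCommS (i : 'I_n.-1) : i.+1 <> 2%N ->
    brD_rel (brD_s ++ brD_sigma i) (brD_sigma i ++ brD_s)
| BrDComm (i j : 'I_n.-1) : (i.+1 < j)%N \/ (j.+1 < i)%N ->
    brD_rel (brD_sigma i ++ brD_sigma j) (brD_sigma j ++ brD_sigma i).

Definition BrD := presented brD_rel.

HB.instance Definition _ := Group.on BrD.

End ArtinD.

Section OrbitConfigurations.
Variables (R : realType) (n : nat).

(* The alias R[i]^o carries the topology of the complex modulus. *)
Local Notation C := (R[i]^o).
Local Notation conf := 'rV[C]_n.
Local Notation I := [set` `[(0 : R), (1 : R)]].

Definition Z2act (h : 'Z_2) (z : C) : C := (-1) ^+ h * z.

Definition Z2orbit (z : C) : set C := range (Z2act^~ z).

Definition orbit_conf : set conf :=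
  [set y | forall i j, i != j ->
    Z2orbit (y ord0 i) `&` Z2orbit (y ord0 j) = set0].

(* twist g s y is the tuple written g y_s, where y_s permutes the entries. *)
Definition twist (g : {ffun 'I_n -> 'Z_2}) (s : 'S_n) (y : conf) : conf :=
  \row_i Z2act (g i) (y ord0 (s i)).

Definition base_conf : conf := \row_(i < n) (i.+1%:R +i* i.+1%:R).

Definition base_orbit : set conf :=
  [set y | exists g s, y = twist g s base_conf].

(* Paths are represented by functions on R that only matter on [0, 1]. *)
Definition orbit_path (a : R -> conf) : Prop :=
  {within I, continuous a} /\ (forall t, I t -> orbit_conf (a t)).

Definition homotopic (a b : R -> conf) : Prop :=
  exists H : R * R -> conf,
    [/\ {within I `*` I, continuous H},
        forall t u, I t -> I u -> orbit_conf (H (t, u)),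
        forall t, I t -> H (t, 0) = a t /\ H (t, 1) = b t &
        forall u, I u -> H (0, u) = a 0 /\ H (1, u) = a 1].

(* The collection of the strings h c, not their union: the action fixes 0, so
   the union would not determine c up to sign. *)
Definition strings (c : R -> C) : set (set (C * R)) :=
  range (fun h : 'Z_2 => [set (Z2act h (c t), t) | t in I]).

Definition orbit_braid (a : R -> conf) : set (set (set (C * R))) :=
  range (fun i : 'I_n => strings (fun t => a t ord0 i)).

(* The tuples of paths a and b realizing A and B may start anywhere. *)
Definition orbit_braid_equiv (A B : set (set (set (C * R)))) : Prop :=
  exists a b, [/\ orbit_path a, orbit_path b,
    orbit_braid a = A, orbit_braid b = B & homotopic a b].

Record braid_path := BraidPath {
  braid_path_fun :> R -> conf;
  braid_path_orbit_path : orbit_path braid_path_fun;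
  braid_path0 : braid_path_fun 0 = base_conf;
  braid_path1 : base_orbit (braid_path_fun 1) }.

HB.instance Definition _ := gen_eqMixin braid_path.
HB.instance Definition _ := gen_choiceMixin braid_path.

Definition concat (a b : R -> conf) (t : R) : conf :=
  if t <= 2^-1 then a (2 * t) else b (2 * t - 1).

Lemma braid_path_endP (a : braid_path) :
  exists p : {ffun 'I_n -> 'Z_2} * 'S_n, a 1 = twist p.1 p.2 base_conf.
Proof. by have [g [s e]] := braid_path1 a; exists (g, s). Qed.

Definition end_sign (a : braid_path) := (projT1 (cid (braid_path_endP a))).1.
Definition end_perm (a : braid_path) := (projT1 (cid (braid_path_endP a))).2.

Lemma braid_path_end (a : braid_path) :
  a 1 = twist (end_sign a) (end_perm a) base_conf.
Proof. exact: (projT2 (cid (braid_path_endP a))). Qed.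

Lemma Z2actD h k z : Z2act (h + k) z = Z2act h (Z2act k z).
Proof.
rewrite /Z2act mulrA -exprD -signr_odd -[in RHS]signr_odd /=.
by rewrite modn2 oddb.
Qed.

Lemma Z2act0 z : Z2act 0 z = z.
Proof. by rewrite /Z2act expr0 mul1r. Qed.

Lemma Z2actK h : cancel (Z2act h) (Z2act (- h)).
Proof. by move=> z; rewrite -Z2actD addNr Z2act0. Qed.

Lemma Z2act_inj h k z : z != 0 -> Z2act h z = Z2act k z -> h = k.
Proof.
move=> z0 /(mulIf z0).
case: h => [[|[|//]] h]; case: k => [[|[|//]] k] //=;
  rewrite ?expr0 ?expr1 => e; do ?exact: val_inj.
  by have := lt0r_neq0 (@ltr0Sn R[i] 1);
    rewrite -[2%:R]/(1 + 1) {1}e addNr eqxx.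
by have := lt0r_neq0 (@ltr0Sn R[i] 1);
  rewrite -[2%:R]/(1 + 1) -{1}e addNr eqxx.
Qed.

Lemma orbit_confP y :
  orbit_conf y <->
  forall i j, i != j -> forall h, y ord0 i <> Z2act h (y ord0 j).
Proof.
split=> [Fy i j ij h e|Fy i j ij].
  have : (Z2orbit (y ord0 i) `&` Z2orbit (y ord0 j)) (y ord0 i).
    by split; [exists 0; rewrite ?Z2act0|exists h].
  by rewrite Fy.
rewrite -subset0 => _ [[h _ <-] [k _ /(congr1 (Z2act (- h)))]].
by rewrite Z2actK -Z2actD => /esym /(Fy _ _ ij).
Qed.

Lemma twistM g s g' s' y : twist g s (twist g' s' y) =
  twist [ffun i => g i + g' (s i)] (s * s')%g y.
Proof. by apply/rowP=> i; rewrite !mxE !ffunE permM Z2actD. Qed.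

Lemma twist1 y : twist [ffun=> 0] 1 y = y.
Proof. by apply/rowP=> i; rewrite !mxE !ffunE perm1 Z2act0. Qed.

Definition inv_sign (g : {ffun 'I_n -> 'Z_2}) (s : 'S_n) :=
  [ffun i => - g ((s^-1)%g i)] : {ffun 'I_n -> 'Z_2}.

Lemma twistK g s : cancel (twist g s) (twist (inv_sign g s) s^-1).
Proof.
move=> y; rewrite twistM mulVg -[RHS]twist1; congr (twist _ _ _).
by apply/ffunP=> i; rewrite !ffunE addNr.
Qed.

Lemma twistVK g s : cancel (twist (inv_sign g s) s^-1) (twist g s).
Proof.
move=> y; rewrite twistM mulgV -[RHS]twist1; congr (twist _ _ _).
by apply/ffunP=> i; rewrite !ffunE permK addrN.
Qed.

Lemma orbit_conf_twist g s y : orbit_conf y -> orbit_conf (twist g s y).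
Proof.
move=> /orbit_confP Fy; apply/orbit_confP => i j ij h.
rewrite !mxE -Z2actD => /(congr1 (Z2act (- g i))).
rewrite Z2actK -Z2actD; apply: Fy; apply: contra_neq ij; exact: perm_inj.
Qed.

Lemma orbit_conf_base : orbit_conf base_conf.
Proof.
apply/orbit_confP => i j ij h; rewrite !mxE /Z2act.
case: h => [[|[|//]] h] /=; rewrite ?expr0 ?mul1r ?expr1 ?mulN1r.
  by case=> /eqP; rewrite eqr_nat eqSS => /eqP /val_inj /eqP;
    rewrite (negPf ij).
case=> /eqP; rewrite eq_sym -subr_eq0 -opprD oppr_eq0 -natrD pnatr_eq0.
by rewrite addSn.
Qed.

Lemma base_conf_neq0 i : base_conf ord0 i != 0.
Proof. by rewrite mxE eq_complex /= pnatr_eq0. Qed.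

Lemma twist_base_inj g s g' s' :
  twist g s base_conf = twist g' s' base_conf -> g = g' /\ s = s'.
Proof.
move=> /rowP e; have es : s = s'.
  apply/permP=> i; apply/eqP/negP=> /negP ne.
  have := e i; rewrite !mxE => /(congr1 (Z2act (- g i))).
  rewrite Z2actK -Z2actD.
  have /orbit_confP/(_ _ _ ne) := orbit_conf_base.
  by move=> /(_ (- g i + g' i)); rewrite !mxE.
subst s'; split=> //; apply/ffunP=> i.
by have := e i; rewrite mxE [RHS]mxE; exact/Z2act_inj/base_conf_neq0.
Qed.

Lemma end_uniq (a : braid_path) g s :
  a 1 = twist g s base_conf -> end_sign a = g /\ end_perm a = s.
Proof. by rewrite braid_path_end => /twist_base_inj. Qed.

Lemma conf_continuous (T : topologicalType) (f : T -> conf) :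
  (forall i, continuous (fun x => f x ord0 i)) -> continuous f.
Proof.
move=> cf x A [P nP PA]; rewrite /= nbhs_simpl /=.
suff : \forall y \near x, forall i : 'I_n, P ord0 i (f y ord0 i).
  by apply: filterS => y Py; apply: PA => i j; rewrite ord1.
by apply: filter_forall => i; exact: (cf i x _ (nP ord0 i)).
Qed.

Lemma conf_coord_continuous (T : topologicalType) (f : T -> conf) i :
  continuous f -> continuous (fun x => f x ord0 i).
Proof.
move=> cf x A nA; apply: (cf x [set M | A (M ord0 i)]).
exists (fun _ j => [set z | j = i -> A z]) => [k j|M /=].
  by rewrite ord1; have [->|/eqP ji] := eqVneq j i;
    [apply: filterS nA => ? ? _|apply: filterS filterT => ? _ /ji].
exact.
Qed.

Lemma twist_continuous g s (T : topologicalType) (f : T -> conf) :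
  continuous f -> continuous (fun x => twist g s (f x)).
Proof.
move=> cf; apply: conf_continuous => i.
rewrite [X in continuous X](_ : _ = (fun x => (-1) ^+ g i *: (f x ord0 (s i)))).
  by move=> x; apply: cvgZl_tmp; exact: conf_coord_continuous.
by apply/funext => x; rewrite mxE.
Qed.


Lemma itv01P t : I t <-> 0 <= t <= 1.
Proof. by rewrite /= in_itv. Qed.

Lemma within_comp (T U V : topologicalType) (A : set T) (B : set U)
    (f : T -> U) (g : U -> V) :
  {within A, continuous f} -> (forall x, A x -> B (f x)) ->
  {within B, continuous g} -> {within A, continuous (g \o f)}.
Proof.
move=> /subspace_continuousP cf AB /subspace_continuousP cg.
apply/subspace_continuousP => x Ax.
apply: (@cvg_comp _ _ _ f g _ (within B (nbhs (f x)))); last exact/cg/AB.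
move=> S /= nS; rewrite /within /= nbhs_simpl /=.
have := cf x Ax _ nS; rewrite /within /= !nbhs_simpl /=.
by apply: filterS => y fy Ay; apply: fy => //; exact: AB.
Qed.

Lemma pair_continuous (T U V : topologicalType) (f : T -> U) (g : T -> V) :
  continuous f -> continuous g -> continuous (fun x => (f x, g x)).
Proof.
move=> cf cg x.
exact: (@cvg_pair _ _ _ _ _ _ _ _ _ _ _ (cf x) (cg x)).
Qed.

Lemma within_twist (T : topologicalType) (A : set T) g s (f : T -> conf) :
  {within A, continuous f} -> {within A, continuous (twist g s \o f)}.
Proof. exact: (@twist_continuous g s (subspace A)). Qed.

Lemma within_paste (T U : topologicalType) (D : set T) (p : T -> R)
    (f g : T -> U) (c : R) :
  closed D -> continuous p ->
  (forall x, D x -> p x = c -> f x = g x) ->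
  {within D `&` [set x | p x <= c], continuous f} ->
  {within D `&` [set x | c <= p x], continuous g} ->
  {within D, continuous (fun x => if p x <= c then f x else g x)}.
Proof.
move=> cD cp fg cf cg.
rewrite [X in {within X, continuous _}](_ : D =
  (D `&` [set x | p x <= c]) `|` (D `&` [set x | c <= p x])); last first.
  apply/seteqP; split=> [x Dx|x [[]|[]]//].
  by have [pc|/ltW pc] := leP (p x) c; [left|right].
apply: withinU_continuous.
- apply: closedI => //; apply: (@preimage_closed _ _ p [set x | x <= c]).
    by move=> x _; exact: cp.
  exact: closed_le.
- apply: closedI => //; apply: (@preimage_closed _ _ p [set x | c <= x]).
    by move=> x _; exact: cp.
  exact: closed_ge.
- apply: subspace_eq_continuous cf => x /set_mem [_ /= pc].
  by rewrite /from_subspace pc.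
- apply: subspace_eq_continuous cg => x /set_mem [Dx /= pc].
  rewrite /from_subspace; case: ifPn => // pc'.
  by rewrite fg //; apply/le_anti/andP.
Qed.

Lemma closed_square : closed (I `*` I).
Proof.
rewrite [X in closed X](_ : _ =
  (fun x : R * R => x.1) @^-1` I `&` (fun x : R * R => x.2) @^-1` I) //.
apply: closedI; apply: preimage_closed; try exact: itv_closed.
  by move=> x _; exact: cvg_fst.
by move=> x _; exact: cvg_snd.
Qed.

Lemma orbit_path_twist g s a : orbit_path a -> orbit_path (twist g s \o a).
Proof.
move=> [ca Fa]; split; first exact: within_twist.
by move=> t It; apply/orbit_conf_twist/Fa.
Qed.

Lemma orbit_path_reparam a (f : R -> R) :
  continuous f -> (forall t, I t -> I (f t)) ->
  orbit_path a -> orbit_path (a \o f).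
Proof.
move=> cf fI [ca Fa]; split; last by move=> t /fI /Fa.
by apply: within_comp ca => //; exact: continuous_subspaceT.
Qed.

Lemma mul2_continuous : continuous (fun t : R => 2 * t).
Proof. by move=> t; apply: cvgM; [exact: cvg_cst|exact: cvg_id]. Qed.

Lemma mul2B1_continuous : continuous (fun t : R => 2 * t - 1).
Proof.
move=> t; apply: cvgB; last exact: cvg_cst.
exact: mul2_continuous.
Qed.

Lemma onem_continuous : continuous (fun t : R => 1 - t).
Proof. by move=> t; apply: cvgB; [exact: cvg_cst|exact: cvg_id]. Qed.

Lemma orbit_path_concat a b :
  orbit_path a -> orbit_path b -> a 1 = b 0 -> orbit_path (concat a b).
Proof.
move=> [ca Fa] [cb Fb] ab; split.
  apply: (within_paste (p := id)).
  - exact: itv_closed.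
  - by move=> ?; exact: cvg_id.
  - move=> t _ ->; rewrite (_ : 2 * 2^-1 = 1); last by lra.
    by rewrite subrr.
  - apply: (within_comp _ _ ca).
      exact/continuous_subspaceT/mul2_continuous.
    by move=> t [/itv01P/andP[? ?] /= ?]; apply/itv01P/andP; split; lra.
  - apply: (within_comp _ _ cb).
      exact/continuous_subspaceT/mul2B1_continuous.
    by move=> t [/itv01P/andP[? ?] /= ?]; apply/itv01P/andP; split; lra.
move=> t /itv01P/andP[? ?]; rewrite /concat; case: leP => ?.
  by apply/Fa/itv01P/andP; split; lra.
by apply/Fb/itv01P/andP; split; lra.
Qed.

Lemma I0 : I 0. Proof. by apply/itv01P; rewrite lexx ler01. Qed.
Lemma I1 : I 1. Proof. by apply/itv01P; rewrite lexx ler01. Qed.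

Lemma homotopic_ends a b : homotopic a b -> a 0 = b 0 /\ a 1 = b 1.
Proof.
move=> [H [_ _ Hab He]].
have [] := Hab _ I0; have [] := Hab _ I1; have [] := He _ I0.
have [] := He _ I1; by move=> -> -> _ _ _ <- _ <-.
Qed.

Lemma homotopic_eq a b :
  orbit_path a -> (forall t, I t -> a t = b t) -> homotopic a b.
Proof.
move=> [ca Fa] ab; exists (fun x => a x.1); split=> /=.
- apply: (within_comp _ _ ca).
    by apply: continuous_subspaceT => x; exact: cvg_fst.
  by move=> x [].
- by move=> t u It _; exact: Fa.
- by move=> t It; rewrite ab.
- by [].
Qed.

Lemma homotopic_sym a b : homotopic a b -> homotopic b a.
Proof.
move=> ab; have [a0 a1] := homotopic_ends ab.
have [H [cH FH Hab He]] := ab.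
have I1m u : I u -> I (1 - u).
  by move=> /itv01P/andP[? ?]; apply/itv01P/andP; split; lra.
exists (fun x => H (x.1, 1 - x.2)); split=> /=.
- apply: (within_comp _ _ cH).
    apply: continuous_subspaceT; apply: pair_continuous => x.
        exact: cvg_fst.
    by apply: cvgB; [exact: cvg_cst|exact: cvg_snd].
  by move=> x [/= ? ?]; split=> //=; exact: I1m.
- by move=> t u It Iu; apply: FH => //; exact: I1m.
- by move=> t /Hab []; rewrite subr0 subrr.
- by move=> u /I1m /He []; rewrite a0 a1.
Qed.

Lemma homotopic_trans b a c : homotopic a b -> homotopic b c -> homotopic a c.
Proof.
move=> ab bc; have [ab0 ab1] := homotopic_ends ab.
have [H [cH FH Hab He]] := ab; have [K [cK FK Kbc Ke]] := bc.
exists (fun x =>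
  if x.2 <= 2^-1 then H (x.1, 2 * x.2) else K (x.1, 2 * x.2 - 1)).
split=> /=.
- apply: within_paste.
  + exact: closed_square.
  + by move=> x; exact: cvg_snd.
  + move=> [t u] [/= It Iu] ->; rewrite (_ : 2 * 2^-1 = 1); last by lra.
    by rewrite subrr; have [_ ->] := Hab _ It; have [->] := Kbc _ It.
  + apply: (within_comp _ _ cH).
      apply: continuous_subspaceT; apply: pair_continuous => x.
        exact: cvg_fst.
      by apply: cvgM; [exact: cvg_cst|exact: cvg_snd].
    move=> [t u] /= [[/= It /itv01P/andP[? ?]] ?]; split=> //=.
    by apply/itv01P/andP; split; lra.
  + apply: (within_comp _ _ cK).
      apply: continuous_subspaceT; apply: pair_continuous => x.
        exact: cvg_fst.
      apply: cvgB; last exact: cvg_cst.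
      by apply: cvgM; [exact: cvg_cst|exact: cvg_snd].
    move=> [t u] /= [[/= It /itv01P/andP[? ?]] ?]; split=> //=.
    by apply/itv01P/andP; split; lra.
- move=> t u It /itv01P/andP[? ?]; case: leP => ?.
    by apply: FH => //; apply/itv01P/andP; split; lra.
  by apply: FK => //; apply/itv01P/andP; split; lra.
- move=> t It; rewrite mulr0 invr_ge0 ler0n; split.
    by have [] := Hab _ It.
  rewrite ifF; last by apply/negbTE; rewrite -ltNge; lra.
  by rewrite (_ : 2 * 1 - 1 = 1); [have [] := Kbc _ It|lra].
- move=> u /itv01P/andP[? ?]; case: leP => ?.
    by apply: He; apply/itv01P/andP; split; lra.
  by rewrite ab0 ab1; apply: Ke; apply/itv01P/andP; split; lra.
Qed.

Lemma homotopic_twist g s a b :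
  homotopic a b -> homotopic (twist g s \o a) (twist g s \o b).
Proof.
move=> [H [cH FH Hab He]]; exists (twist g s \o H); split=> /=.
- exact: within_twist.
- by move=> t u It Iu; apply/orbit_conf_twist/FH.
- by move=> t /Hab [-> ->].
- by move=> u /He [-> ->].
Qed.

Lemma homotopic_concat a a' b b' : homotopic a a' -> homotopic b b' ->
  a 1 = b 0 -> homotopic (concat a b) (concat a' b').
Proof.
move=> [H [cH FH Haa' He]] [K [cK FK Kbb' Ke]] ab.
exists (fun x =>
  if x.1 <= 2^-1 then H (2 * x.1, x.2) else K (2 * x.1 - 1, x.2)).
split=> /=.
- apply: within_paste.
  + exact: closed_square.
  + by move=> x; exact: cvg_fst.
  + move=> [t u] [/= It Iu] ->; rewrite (_ : 2 * 2^-1 = 1); last by lra.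
    by rewrite subrr; have [_ ->] := He _ Iu; have [->] := Ke _ Iu.
  + apply: (within_comp _ _ cH).
      apply: continuous_subspaceT; apply: pair_continuous => x;
        last exact: cvg_snd.
      by apply: cvgM; [exact: cvg_cst|exact: cvg_fst].
    move=> [t u] /= [[/= /itv01P/andP[? ?] It] ?]; split=> //=.
    by apply/itv01P/andP; split; lra.
  + apply: (within_comp _ _ cK).
      apply: continuous_subspaceT; apply: pair_continuous => x;
        last exact: cvg_snd.
      apply: cvgB; last exact: cvg_cst.
      by apply: cvgM; [exact: cvg_cst|exact: cvg_fst].
    move=> [t u] /= [[/= /itv01P/andP[? ?] It] ?]; split=> //=.
    by apply/itv01P/andP; split; lra.
- move=> t u /itv01P/andP[? ?] Iu; case: leP => ?.
    by apply: FH => //; apply/itv01P/andP; split; lra.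
  by apply: FK => //; apply/itv01P/andP; split; lra.
- move=> t /itv01P/andP[? ?]; rewrite /concat; case: leP => ?.
    by apply: Haa'; apply/itv01P/andP; split; lra.
  by apply: Kbb'; apply/itv01P/andP; split; lra.
- move=> u Iu; rewrite /concat mulr0 invr_ge0 ler0n.
  have [-> _] := He _ Iu; split=> //.
  rewrite ifF; last by apply/negbTE; rewrite -ltNge; lra.
  rewrite ifF; last by apply/negbTE; rewrite -ltNge; lra.
  by rewrite (_ : 2 * 1 - 1 = 1); [have [] := Ke _ Iu|lra].
Qed.

Lemma homotopic_reparam a (f g : R -> R) : orbit_path a ->
  continuous f -> continuous g ->
  (forall t, I t -> I (f t)) -> (forall t, I t -> I (g t)) ->
  f 0 = g 0 -> f 1 = g 1 -> homotopic (a \o f) (a \o g).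
Proof.
move=> [ca Fa] cf cg fI gI fg0 fg1.
pose h (x : R * R) := (1 - x.2) * f x.1 + x.2 * g x.1.
have hI x : (I `*` I) x -> I (h x).
  case: x => t u [/= It /itv01P/andP[u0 u1]]; rewrite /h /=.
  have /itv01P/andP[f0 f1] := fI _ It; have /itv01P/andP[g0 g1] := gI _ It.
  by apply/itv01P/andP; split; nra.
exists (a \o h); split.
- apply: (within_comp _ hI ca); apply: continuous_subspaceT => x.
  apply: cvgD; apply: cvgM.
  + by apply: cvgB; [exact: cvg_cst|exact: cvg_snd].
  + by apply: continuous_comp; [exact: cvg_fst|exact: cf].
  + exact: cvg_snd.
  + by apply: continuous_comp; [exact: cvg_fst|exact: cg].
- by move=> t u It Iu; apply/Fa/hI.
- by move=> t It; rewrite /h /= subr0 mul1r mul0r addr0 subrr mul0r mul1r add0r.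
- by move=> u Iu; rewrite /h /= -fg0 -fg1 -!mulrDl subrK !mul1r.
Qed.

Lemma orbit_braid_eqP a b : orbit_path a -> orbit_path b ->
  orbit_braid b = orbit_braid a ->
  exists g s, forall t, I t -> b t = twist g s (a t).
Proof.
move=> [_ Fa] [_ Fb] ba.
have /choice[p pP] (i : 'I_n) : exists p : 'I_n * 'Z_2,
    forall t, I t -> b t ord0 i = Z2act p.2 (a t ord0 p.1).
  have : orbit_braid b (strings (fun t => b t ord0 i)) by exists i.
  rewrite ba => -[j _ sji].
  have : strings (fun t => b t ord0 i) [set (Z2act 0 (b t ord0 i), t) | t in I].
    by exists 0.
  rewrite -sji => -[h _ hE]; exists (j, h) => t It /=.
  have : [set (Z2act 0 (b t0 ord0 i), t0) | t0 in I] (Z2act 0 (b t ord0 i), t).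
    by exists t.
  by rewrite -hE => -[u _ [+ ut]]; rewrite ut Z2act0.
have p_inj : injective (fun i => (p i).1).
  move=> i j pij; apply/eqP/negP => /negP ij.
  have /orbit_confP/(_ _ _ ij) := Fb _ I0.
  move=> /(_ ((p i).2 - (p j).2)); apply.
  by rewrite Z2actD !pP ?Z2actK ?pij //; do ?exact: I0.
exists [ffun i => (p i).2], (perm p_inj) => t It; apply/rowP=> i.
by rewrite mxE ffunE permE pP.
Qed.

Lemma orbit_braid_equivP (a b : braid_path) :
  orbit_braid_equiv (orbit_braid a) (orbit_braid b) <-> homotopic a b.
Proof.
have [Pa Pb] := (braid_path_orbit_path a, braid_path_orbit_path b).
split=> [[a' [b' [Pa' Pb' aa' bb' ab]]]|ab]; last by exists a, b.
have [g [s gs]] := orbit_braid_eqP Pa Pa' aa'.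
have [g' [s' gs']] := orbit_braid_eqP Pb Pb' bb'.
have [] := homotopic_ends ab; rewrite (gs _ I0) (gs' _ I0).
rewrite !braid_path0 => /twist_base_inj[eg es] _; subst g' s'.
have {}ab := homotopic_twist (inv_sign g s) s^-1 ab.
apply: (homotopic_trans _ (homotopic_trans ab _)).
  by apply: homotopic_eq => // t It /=; rewrite gs ?twistK.
by apply: homotopic_eq => [|t It /=];
  [exact: orbit_path_twist|rewrite gs' ?twistK].
Qed.

Definition braid_equivb (a b : braid_path) : bool :=
  `[< orbit_braid_equiv (orbit_braid a) (orbit_braid b) >].

Lemma braid_equivbP (a b : braid_path) :
  reflect (homotopic a b) (braid_equivb a b).
Proof. by apply: (iffP (asboolP _)) => /orbit_braid_equivP. Qed.

Lemma braid_equivb_refl : reflexive braid_equivb.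
Proof.
move=> a; apply/braid_equivbP/homotopic_eq => //.
exact: braid_path_orbit_path.
Qed.

Lemma braid_equivb_sym : symmetric braid_equivb.
Proof.
by move=> a b; apply/braid_equivbP/braid_equivbP; exact: homotopic_sym.
Qed.

Lemma braid_equivb_trans : transitive braid_equivb.
Proof.
move=> b a c /braid_equivbP ab /braid_equivbP bc; apply/braid_equivbP.
exact: homotopic_trans bc.
Qed.

Definition braid_equiv :=
  EquivRel _ braid_equivb_refl braid_equivb_sym braid_equivb_trans.

(* The class of a path a stands for the class of its orbit braid. *)
Definition orbit_braid_group := {eq_quot braid_equiv}.

HB.instance Definition _ := Choice.on orbit_braid_group.

Definition braid_mul_fun (a b : braid_path) : R -> conf :=
  concat a (twist (end_sign a) (end_perm a) \o b).

Lemma braid_mul_glue (a b : braid_path) :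
  a 1 = twist (end_sign a) (end_perm a) (b 0).
Proof. by rewrite braid_path0 braid_path_end. Qed.

Lemma concat0 a b : concat a b 0 = a 0.
Proof. by rewrite /concat mulr0 invr_ge0 ler0n. Qed.

Lemma concat1 a b : concat a b 1 = b 1.
Proof.
rewrite /concat ifF; last by apply/negbTE; rewrite -ltNge; lra.
by congr b; lra.
Qed.

Lemma braid_mul_orbit_path a b : orbit_path (braid_mul_fun a b).
Proof.
apply: orbit_path_concat (braid_mul_glue _ _) => //.
  exact: braid_path_orbit_path.
exact/orbit_path_twist/braid_path_orbit_path.
Qed.

Lemma braid_mul0 a b : braid_mul_fun a b 0 = base_conf.
Proof. by rewrite /braid_mul_fun concat0 braid_path0. Qed.

Lemma braid_mul1 a b : base_orbit (braid_mul_fun a b 1).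
Proof.
by rewrite /braid_mul_fun concat1 /= braid_path_end twistM; do 2!eexists.
Qed.

Definition braid_mul a b := BraidPath (braid_mul_orbit_path a b)
  (braid_mul0 a b) (braid_mul1 a b).

Lemma cst_orbit_path : orbit_path (fun=> base_conf).
Proof.
split=> [|? _]; last exact: orbit_conf_base.
by apply: continuous_subspaceT => ?; exact: cvg_cst.
Qed.

Lemma cst_base_orbit : base_orbit base_conf.
Proof. by exists [ffun=> 0], 1%g; rewrite twist1. Qed.

Definition braid_one :=
  BraidPath cst_orbit_path (erefl base_conf) cst_base_orbit.

Definition braid_inv_fun (a : braid_path) : R -> conf :=
  twist (inv_sign (end_sign a) (end_perm a)) (end_perm a)^-1 \o
  (a \o (fun t => 1 - t)).

Lemma braid_inv_orbit_path a : orbit_path (braid_inv_fun a).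
Proof.
apply: orbit_path_twist; apply: orbit_path_reparam.
- exact: onem_continuous.
- by move=> t /itv01P/andP[? ?]; apply/itv01P/andP; split; lra.
- exact: braid_path_orbit_path.
Qed.

Lemma braid_inv0 a : braid_inv_fun a 0 = base_conf.
Proof. by rewrite /braid_inv_fun /= subr0 braid_path_end twistK. Qed.

Lemma braid_inv1 a : base_orbit (braid_inv_fun a 1).
Proof.
by rewrite /braid_inv_fun /base_orbit /= subrr braid_path0; do 2!eexists.
Qed.

Definition braid_inv a :=
  BraidPath (braid_inv_orbit_path a) (braid_inv0 a) (braid_inv1 a).

Lemma end_mul a b :
  end_sign (braid_mul a b) =
    [ffun i => end_sign a i + end_sign b (end_perm a i)] /\
  end_perm (braid_mul a b) = (end_perm a * end_perm b)%g.
Proof.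
apply: end_uniq.
by rewrite /= /braid_mul_fun concat1 /= [b 1]braid_path_end twistM.
Qed.

Lemma end_one : end_sign braid_one = [ffun=> 0] /\ end_perm braid_one = 1%g.
Proof. by apply: end_uniq; rewrite twist1. Qed.

Lemma end_homotopic (a b : braid_path) : homotopic a b ->
  end_sign a = end_sign b /\ end_perm a = end_perm b.
Proof.
by move=> /homotopic_ends[_ e]; apply: end_uniq; rewrite e braid_path_end.
Qed.

Lemma braid_mul_homotopic (a a' b b' : braid_path) :
  homotopic a a' -> homotopic b b' ->
  homotopic (braid_mul a b) (braid_mul a' b').
Proof.
move=> aa' bb'; rewrite /= /braid_mul_fun.
have [<- <-] := end_homotopic aa'.
apply: homotopic_concat => //; first exact: homotopic_twist.
exact: braid_mul_glue.
Qed.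

Lemma braid_mulA_homotopic (a b c : braid_path) :
  homotopic (braid_mul (braid_mul a b) c) (braid_mul a (braid_mul b c)).
Proof.
pose f t : R := Num.min (2 * t) (Num.min (t + 4^-1) (2^-1 * t + 2^-1)).
have fI t : I t -> I (f t).
  move=> /itv01P/andP[? ?]; apply/itv01P; rewrite /f.
  by rewrite !le_min !ge_min; apply/andP; split;
    [apply/and3P; split; lra|apply/orP; right; apply/orP; right; lra].
have cf : continuous f.
  move=> t; apply: continuous_min.
    exact: mul2_continuous.
  apply: continuous_min.
    by apply: cvgD; [exact: cvg_id|exact: cvg_cst].
  apply: cvgD; last exact: cvg_cst.
  by apply: cvgM; [exact: cvg_cst|exact: cvg_id].
apply: (homotopic_trans (b := braid_mul a (braid_mul b c) \o f)).
  apply: homotopic_eq; first exact: braid_path_orbit_path.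
  move=> t /itv01P/andP[? ?]; rewrite /= /braid_mul_fun.
  have [-> ->] := end_mul a b; rewrite /= /braid_mul_fun /concat /=.
  have [t2|t2] := leP t 2^-1; last first.
    rewrite (_ : f t = 2^-1 * t + 2^-1); last first.
      by rewrite /f !(min_idPr _) //; lra.
    rewrite ifF; last by apply/negbTE; rewrite -ltNge; lra.
    rewrite ifF; last by apply/negbTE; rewrite -ltNge; lra.
    rewrite twistM; congr (twist _ _ (c _)); lra.
  have [t4|t4] := leP (2 * t) 2^-1.
    rewrite (_ : f t = 2 * t); last first.
      by rewrite /f (min_idPl _) // le_min; apply/andP; split; lra.
    by rewrite ifT.
  rewrite (_ : f t = t + 4^-1); last first.
    by rewrite /f (min_idPr _) ?(min_idPl _) //; lra.
  rewrite ifF; last by apply/negbTE; rewrite -ltNge; lra.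
  rewrite ifT; last by lra.
  by congr (twist _ _ (b _)); lra.
have f0 : f 0 = 0.
  by rewrite /f (min_idPl _) ?mulr0 // le_min; apply/andP; split; lra.
have f1 : f 1 = 1.
  by rewrite /f !(min_idPr _); lra.
apply: (homotopic_reparam (g := id)) => //; first exact: braid_path_orbit_path.
by move=> ?; exact: cvg_id.
Qed.

Lemma braid_mul1_homotopic (a : braid_path) :
  homotopic (braid_mul braid_one a) a.
Proof.
pose f t : R := Num.max 0 (2 * t - 1).
have fI t : I t -> I (f t).
  move=> /itv01P/andP[? ?]; apply/itv01P; rewrite /f le_max lexx /= ge_max.
  by apply/andP; split; lra.
have cf : continuous f.
  move=> t; apply: (@continuous_max R R (fun=> 0) (fun t => 2 * t - 1)).
    exact: cvg_cst.
  exact: mul2B1_continuous.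
apply: (homotopic_trans (b := a \o f)).
  apply: homotopic_eq; first exact: braid_path_orbit_path.
  move=> t /itv01P/andP[? ?]; rewrite /= /braid_mul_fun.
  have [-> ->] := end_one; rewrite /concat /= twist1.
  case: leP => t2.
    by rewrite /f (max_idPl _) ?braid_path0 //; lra.
  by rewrite /f (max_idPr _) //; lra.
apply: (homotopic_reparam (g := id)) => //.
- exact: braid_path_orbit_path.
- by move=> ?; exact: cvg_id.
- by rewrite /f (max_idPl _) //; lra.
- by rewrite /f (max_idPr _) //; lra.
Qed.

Lemma braid_mulr1_homotopic (a : braid_path) :
  homotopic (braid_mul a braid_one) a.
Proof.
pose f t : R := Num.min (2 * t) 1.
have fI t : I t -> I (f t).
  move=> /itv01P/andP[? ?]; apply/itv01P; rewrite /f ge_min lexx orbT andbT.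
  by rewrite le_min; apply/andP; split; lra.
have cf : continuous f.
  move=> t; apply: (@continuous_min R R (fun t => 2 * t) (fun=> 1));
    last exact: cvg_cst.
  exact: mul2_continuous.
apply: (homotopic_trans (b := a \o f)).
  apply: homotopic_eq; first exact: braid_path_orbit_path.
  move=> t /itv01P/andP[? ?]; rewrite /= /braid_mul_fun /concat /=.
  case: leP => t2.
    by rewrite /f (min_idPl _) //; lra.
  by rewrite /f (min_idPr _) ?braid_path_end //; lra.
apply: (homotopic_reparam (g := id)) => //.
- exact: braid_path_orbit_path.
- by move=> ?; exact: cvg_id.
- by rewrite /f (min_idPl _) //; lra.
- by rewrite /f (min_idPr _) //; lra.
Qed.

Lemma braid_mulV_homotopic (a : braid_path) :
  homotopic (braid_mul a (braid_inv a)) braid_one.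
Proof.
pose f t : R := Num.min (2 * t) (2 - 2 * t).
have fI t : I t -> I (f t).
  move=> /itv01P/andP[? ?]; apply/itv01P; rewrite /f le_min ge_min.
  apply/andP; split; first by apply/andP; split; lra.
  by apply/orP; case: (leP t 2^-1) => ?; [left|right]; lra.
have cf : continuous f.
  move=> t; apply: continuous_min; first exact: mul2_continuous.
  by apply: cvgB; [exact: cvg_cst|exact: mul2_continuous].
apply: (homotopic_trans (b := a \o f)).
  apply: homotopic_eq; first exact: braid_path_orbit_path.
  move=> t /itv01P/andP[? ?].
  rewrite /= /braid_mul_fun /concat /= /braid_inv_fun /= twistVK /f.
  case: leP => t2; first by rewrite (min_idPl _) //; lra.
  by rewrite (min_idPr _); [congr (a _)|]; lra.
apply: (homotopic_trans (b := a \o fun=> 0)); last first.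
  apply: homotopic_eq => [|t _ /=]; last by rewrite braid_path0.
  apply: orbit_path_reparam (braid_path_orbit_path a).
    by move=> ?; exact: cvg_cst.
  by move=> ? _; exact: I0.
apply: homotopic_reparam => //.
- exact: braid_path_orbit_path.
- by move=> ?; exact: cvg_cst.
- by move=> ? _; exact: I0.
- by rewrite /f (min_idPl _); lra.
- by rewrite /f (min_idPr _); lra.
Qed.

Local Notation cls := (\pi_orbit_braid_group).

Definition obg_one : orbit_braid_group := cls braid_one.
Definition obg_mul (x y : orbit_braid_group) : orbit_braid_group :=
  cls (braid_mul (repr x) (repr y)).
Definition obg_inv (x : orbit_braid_group) : orbit_braid_group :=
  cls (braid_inv (repr x)).

Lemma obg_piP (a b : braid_path) : cls a = cls b <-> homotopic a b.
Proof. by split=> [/eqmodP/braid_equivbP|?] //; apply/eqmodP/braid_equivbP. Qed.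

Lemma obg_ind (P : orbit_braid_group -> Prop) :
  (forall a, P (cls a)) -> forall x, P x.
Proof. by move=> Pa x; rewrite -[x]reprK; exact: Pa. Qed.

Lemma obg_repr (a : braid_path) : homotopic (repr (cls a)) a.
Proof. by apply/obg_piP; rewrite reprK. Qed.

Lemma obg_mulE (a b : braid_path) :
  obg_mul (cls a) (cls b) = cls (braid_mul a b).
Proof. by apply/obg_piP/braid_mul_homotopic; exact: obg_repr. Qed.

Lemma obg_mulA : associative obg_mul.
Proof.
elim/obg_ind=> a; elim/obg_ind=> b; elim/obg_ind=> c; rewrite !obg_mulE.
exact/esym/obg_piP/braid_mulA_homotopic.
Qed.

Lemma obg_mul1 : left_id obg_one obg_mul.
Proof.
by elim/obg_ind=> a; rewrite obg_mulE; apply/obg_piP/braid_mul1_homotopic.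
Qed.

Lemma obg_mulr1 : right_id obg_one obg_mul.
Proof.
by elim/obg_ind=> a; rewrite obg_mulE; apply/obg_piP/braid_mulr1_homotopic.
Qed.

Lemma obg_mulgV : right_inverse obg_one obg_inv obg_mul.
Proof.
move=> x; rewrite -{1}[x]reprK obg_mulE.
exact/obg_piP/braid_mulV_homotopic.
Qed.

Lemma obg_mulVg : left_inverse obg_one obg_inv obg_mul.
Proof.
move=> x; rewrite -[LHS]obg_mulr1 -(obg_mulgV (obg_inv x)).
by rewrite obg_mulA -[X in obg_mul X _]obg_mulA obg_mulgV obg_mulr1 obg_mulgV.
Qed.

HB.instance Definition _ := isGroup.Build orbit_braid_group
  obg_mulA obg_mul1 obg_mulr1 obg_mulVg obg_mulgV.

End OrbitConfigurations.

(* Main.v *)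
Require Import Defs.
From HB Require Import structures.
From mathcomp Require Import all_boot all_order all_algebra all_fingroup.
From mathcomp Require Import generic_quotient complex.
From mathcomp Require Import boolp classical_sets functions reals topology.
From mathcomp Require Import normedtype lra ring zify.

(* The homomorphism sends a generator to the braid of a path lifting the
   corresponding reflection, and its injectivity comes from a left inverse
   with values in Br(D_n) itself, given by the holonomy of a cocycle on the
   configuration space. Write z = x + i y; then z is an orbit configuration
   iff no root vanishes on both x and y. Let T(y) be the product of the
   generators that sort y into the fundamental chamber by reflections in
   negative simple roots (well defined, as the sorting process is locally
   confluent by the braid relations). Move x into the fundamental chamber by
   an element w of the Coxeter group; the change of T(w y) along a move of x
   in real space only depends on the signs at y of the roots that change sign
   on x. So near any configuration this defines a cocycle, whose product
   along the points of a fine subdivision of a path is invariant under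
   homotopy and under the Coxeter group, and takes the value s on the path
   lifting the simple reflection s. *)

Set Implicit Arguments.
Unset Strict Implicit.
Unset Printing Implicit Defensive.

Import Order.TTheory GRing.Theory Num.Theory numFieldNormedType.Exports.

Local Open Scope classical_set_scope.
Local Open Scope ring_scope.
Local Open Scope complex_scope.
Local Open Scope quotient_scope.

(** * Reflections and roots *)

Section Reflections.
Variables (R : realType) (m : nat).
Local Notation n := m.+2.
Local Notation V := 'rV[R]_n.
Local Notation gen := (brD_gen n).
Local Notation signed_perm := ({ffun 'I_n -> 'Z_2} * 'S_n)%type.

Lemma rv_eq (K : Type) k (u v : 'rV[K]_k) :
  (forall i, u ord0 i = v ord0 i) -> u = v.
Proof. by move=> e; apply/rowP => i; exact: e. Qed.

(** The generators s and sigma_1 share the index 0: both act on the first two coordinates, and only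
    [neg] tells them apart. *)
Definition idx (s : gen) : nat := if s is Some i then i else 0.
Definition lo (s : gen) : 'I_n := inord (idx s).
Definition hi (s : gen) : 'I_n := inord (idx s).+1.
Definition neg (s : gen) : bool := s == None.

Lemma idx_lt s : (idx s < m.+1)%N.
Proof. by case: s => [i|] //=. Qed.

Lemma loE s : lo s = idx s :> nat.
Proof. by rewrite inordK // ltnW // ltnS idx_lt. Qed.

Lemma hiE s : hi s = (idx s).+1 :> nat.
Proof. by rewrite inordK // ltnS idx_lt. Qed.

Lemma lo_hi s : lo s != hi s.
Proof. by rewrite -val_eqE /= loE hiE neq_ltn ltnSn. Qed.

Lemma neg_idx s : neg s -> idx s = 0%N.
Proof. by move=> /eqP ->. Qed.

Definition act (w : signed_perm) (v : V) : V :=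
  \row_i ((-1) ^+ w.1 i * v ord0 (w.2 i)).

Definition refl (s : gen) : signed_perm :=
  ([ffun i => if neg s && ((i == lo s) || (i == hi s)) then 1 else 0],
   tperm (lo s) (hi s)).

Definition simple (s : gen) (v : V) : R :=
  v ord0 (hi s) - (-1) ^+ neg s * v ord0 (lo s).

Definition coroot (s : gen) : V :=
  \row_i ((i == hi s)%:R - (-1) ^+ neg s * (i == lo s)%:R).

Lemma act_refl s v : act (refl s) v = v - simple s v *: coroot s.
Proof.
apply/rv_eq => i; rewrite !mxE !ffunE /simple /=.
have lh := negPf (lo_hi s).
have [->|il] := eqVneq i (lo s).
  rewrite tpermL lh orTb andbT; case: (neg s); rewrite ?expr0 ?expr1 /=; ring.
have [->|ih] := eqVneq i (hi s).
  rewrite tpermR orbT andbT; case: (neg s); rewrite ?expr0 ?expr1 /=; ring.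
by rewrite tpermD 1?eq_sym // andbF expr0 /=; ring.
Qed.

Lemma simpleB s v w c : simple s (v - c *: w) = simple s v - c * simple s w.
Proof. by rewrite /simple !mxE; ring. Qed.

(** The edges of the Dynkin diagram D_n. Since s and sigma_1 both have index 0, each is joined to
    sigma_2 and they are not joined to each other. *)
Definition adjacent (s t : gen) : bool :=
  (idx s == (idx t).+1) || (idx t == (idx s).+1).

(** This is the Cartan matrix of type D_n; the relations between the reflections follow from it by
    linear algebra. *)
Lemma simple_coroot s t : simple t (coroot s) =
  if s == t then 2 else if adjacent s t then -1 else 0.
Proof.
have eo (i j : 'I_n) : (i == j) = (i == j :> nat) by [].
rewrite /simple !mxE /= !eo !loE !hiE eqSS /adjacent.
have [<-|st] := eqVneq s t.
  rewrite eqxx (gtn_eqF (ltnSn _)) (ltn_eqF (ltnSn _)).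
  by case: (neg s); rewrite ?expr0 ?expr1 /=; ring.
(* Distinct generators of equal index are s and sigma_1; their opposite signs make the two terms
   cancel. *)
have [e|ne] := eqVneq (idx t) (idx s).
  rewrite e (gtn_eqF (ltnSn _)) (ltn_eqF (ltnSn _)) /=.
  have : neg s != neg t.
    apply: contra st; rewrite /neg; case: s t e => [i|] [j|] //= /val_inj -> _.
    exact: eqxx.
  by case: (neg s); case: (neg t) => //= _; rewrite ?expr0 ?expr1 /=; ring.
rewrite (eq_sym (idx s)) /=.
have [e|/= ne1] := eqVneq (idx t).+1 (idx s).
  rewrite -e (ltn_eqF (leqnSn (idx t).+1)) /=.
  have /negPf -> : ~~ neg s by apply/negP => /neg_idx; rewrite -e.
  by rewrite expr0; ring.
have [e|/= ne2] := eqVneq (idx t) (idx s).+1; last by rewrite /=; ring.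
have /negPf -> : ~~ neg t by apply/negP => /neg_idx; rewrite e.
by rewrite expr0 /=; ring.
Qed.

Lemma adjacent_sym s t : adjacent s t = adjacent t s.
Proof. by rewrite /adjacent orbC. Qed.

Lemma adjacent_neq s t : adjacent s t -> s != t.
Proof.
by apply: contraTneq => ->; rewrite /adjacent (ltn_eqF (ltnSn _)).
Qed.

Lemma act_reflK s v : act (refl s) (act (refl s) v) = v.
Proof.
rewrite !act_refl simpleB simple_coroot eqxx.
by apply/rv_eq => i; rewrite !mxE; ring.
Qed.

Lemma simple_refl s v : simple s (act (refl s) v) = - simple s v.
Proof. by rewrite act_refl simpleB simple_coroot eqxx; ring. Qed.

Lemma simple_refl_comm s t v : s != t -> ~~ adjacent s t ->
  simple t (act (refl s) v) = simple t v.
Proof.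
by move=> /negPf st /negPf a; rewrite act_refl simpleB simple_coroot st a; ring.
Qed.

Lemma simple_refl_braid s t v : adjacent s t ->
  simple t (act (refl s) v) = simple t v + simple s v.
Proof.
move=> a; rewrite act_refl simpleB simple_coroot (negPf (adjacent_neq a)) a.
by ring.
Qed.

Lemma act_refl_comm s t v : s != t -> ~~ adjacent s t ->
  act (refl s) (act (refl t) v) = act (refl t) (act (refl s) v).
Proof.
move=> st a; rewrite [LHS]act_refl [RHS]act_refl.
rewrite simple_refl_comm // 1?eq_sym // 1?adjacent_sym //.
rewrite simple_refl_comm // !act_refl.
by apply/rv_eq => i; rewrite !mxE; ring.
Qed.

Lemma act_refl_braid s t v : adjacent s t ->
  act (refl s) (act (refl t) (act (refl s) v)) =
  act (refl t) (act (refl s) (act (refl t) v)).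
Proof.
move=> a; have a' : adjacent t s by rewrite adjacent_sym.
rewrite [LHS]act_refl [RHS]act_refl.
rewrite (simple_refl_braid _ a) (simple_refl_braid _ a') !simple_refl.
rewrite (simple_refl_braid _ a) (simple_refl_braid _ a').
rewrite ![act _ (act _ _)]act_refl.
rewrite (simple_refl_braid _ a) (simple_refl_braid _ a') !act_refl.
by apply/rv_eq => i; rewrite !mxE; ring.
Qed.

(** * The group of signed permutations and its action on roots *)

Definition spmul (w w' : signed_perm) : signed_perm :=
  ([ffun i => w.1 i + w'.1 (w.2 i)], (w.2 * w'.2)%g).

Definition spinv (w : signed_perm) : signed_perm :=
  (inv_sign w.1 w.2, (w.2^-1)%g).

Lemma signZ2D (K : pzRingType) (h k : 'Z_2) :
  (-1) ^+ (h + k)%R = (-1) ^+ h * (-1) ^+ k :> K.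
Proof.
rewrite -exprD -signr_odd -[in RHS]signr_odd /=.
by rewrite modn2 oddb.
Qed.

Lemma act_spmul w w' v : act (spmul w w') v = act w (act w' v).
Proof. by apply/rv_eq => i; rewrite !mxE !ffunE permM signZ2D mulrA. Qed.

Lemma act_id v : act ([ffun=> 0], 1%g) v = v.
Proof. by apply/rv_eq => i; rewrite !mxE ffunE perm1 expr0 mul1r. Qed.

Lemma act_spinvK w v : act w (act (spinv w) v) = v.
Proof.
rewrite -act_spmul -[RHS]act_id; congr (act (_, _) v); last by rewrite /= mulgV.
by apply/ffunP => i; rewrite !ffunE /= permK addrN.
Qed.

Lemma act_spinvVK w v : act (spinv w) (act w v) = v.
Proof.
rewrite -act_spmul -[RHS]act_id; congr (act (_, _) v); last by rewrite /= mulVg.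
by apply/ffunP => i; rewrite !ffunE /= addNr.
Qed.

Definition root (i j : 'I_n) (b : bool) (v : V) : R :=
  v ord0 i + (-1) ^+ b * v ord0 j.

Lemma sign_sqr (K : pzRingType) k : (-1) ^+ k * (-1) ^+ k = 1 :> K.
Proof. by rewrite -exprD addnn -signr_odd odd_double. Qed.

Lemma root_act w i j b : exists b',
  forall v, root i j b (act w v) = (-1) ^+ w.1 i * root (w.2 i) (w.2 j) b' v.
Proof.
exists (b (+) odd (w.1 i) (+) odd (w.1 j)) => v.
rewrite /root !mxE !signr_addb !signr_odd mulrDr; congr (_ + _).
have := @sign_sqr R (w.1 i); set c := _ ^+ w.1 i => c2; rewrite -[LHS]mul1r
  -{1}c2.
by ring.
Qed.

(** A product of two values of a root only tells whether two points lie on the same side of a wall;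
    it forgets the sign of the root, so signed permutations simply permute these products. *)
Lemma root_act2 w i j b : exists b', forall v v' : V,
  root i j b (act w v) * root i j b (act w v') =
  root (w.2 i) (w.2 j) b' v * root (w.2 i) (w.2 j) b' v'.
Proof.
have [b' e] := root_act w i j b; exists b' => v v'.
by rewrite !e mulrACA sign_sqr mul1r.
Qed.

Definition generic (v : V) : Prop := forall i j b, i != j -> root i j b v != 0.

Lemma generic_act w v : generic v -> generic (act w v).
Proof.
move=> gv i j b ij; have [b' ->] := root_act w i j b.
rewrite mulf_neq0 ?signr_eq0 //; apply: gv.
by rewrite (inj_eq perm_inj).
Qed.

Lemma simpleE s v : simple s v = root (hi s) (lo s) (~~ neg s) v.
Proof. by rewrite /simple /root; case: (neg s); rewrite /= ?expr0 ?expr1; ring.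
  Qed.

Lemma generic_simple s v : generic v -> simple s v != 0.
Proof. by move=> gv; rewrite simpleE gv // eq_sym lo_hi. Qed.

Lemma generic_simpleP s v : generic v -> (simple s v <= 0) = (simple s v < 0).
Proof. by move=> gv; rewrite le_eqVlt (negPf (generic_simple s gv)). Qed.

Definition chamber (v : V) : Prop := forall s, 0 < simple s v.

(** The simple roots bound the region |v_0| < v_1 < v_2 < ..., in which v_i lies strictly between
    -v_j and v_j whenever i < j. *)
Lemma chamber_root v (i j : 'I_n) b : chamber v -> (i < j)%N -> 0 < root j i b
    v.
Proof.
move=> cv ij.
suff /andP[h1 h2] : - v ord0 j < v ord0 i < v ord0 j.
  by rewrite /root; case: b; rewrite ?expr0 ?expr1; lra.
(* Here [None] is s and [Some ord0] is sigma_1; together they give |v_0| < v_1. *)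
have h0 : - v ord0 (inord 1) < v ord0 (inord 0) < v ord0 (inord 1).
  have := cv None; have := cv (Some ord0); rewrite /simple /hi /lo /=.
  by rewrite expr0 expr1 => ? ?; apply/andP; split; lra.
have step k : (k.+1 < n)%N -> v ord0 (inord k) < v ord0 (inord k.+1).
  rewrite ltnS => kn; have := cv (Some (Ordinal kn)).
  by rewrite /simple /hi /lo /= expr0; lra.
have pos k : (k.+1 < n)%N -> 0 < v ord0 (inord k.+1).
  elim: k => [_|k IH kn]; first by lra.
  by have := step _ kn; have := IH (ltnW kn); lra.
have abs k : (k < n)%N -> - v ord0 (inord k.+1) < v ord0 (inord k) ->
    forall l, (k + l.+1 < n)%N ->
    - v ord0 (inord (k + l.+1)) < v ord0 (inord k) < v ord0 (inord (k + l.+1)).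
  move=> kn h; elim=> [|l IH] kl.
    by rewrite addn1 h step // -addn1.
  have kl1 : (k + l.+1 < n)%N by move: kl; rewrite addnS => /ltnW.
  have /andP[h1 h2] := IH kl1.
  have := step (k + l.+1)%N; rewrite -addnS => /(_ kl) h3.
  by apply/andP; split; lra.
have key : - v ord0 (inord i.+1) < v ord0 (inord i).
  case: (i : nat) (leq_ltn_trans ij (ltn_ord j)) => [|k] kn; first by lra.
  by have := pos _ kn; have := pos _ (ltnW kn); lra.
have := abs i (ltn_ord i) key (j - i.+1)%N.
rewrite (_ : i + (j - i.+1).+1 = j)%N ?ltn_ord ?inord_val; first exact.
by rewrite addnS -addSn subnKC.
Qed.

End Reflections.

(** * Simple reflections of the fundamental chamber, heights and sorting words *)

Section Chambers.
Variables (R : realType) (m : nat).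
Local Notation n := m.+2.
Local Notation V := 'rV[R]_n.
Local Notation gen := (brD_gen n).
Local Notation signed_perm := ({ffun 'I_n -> 'Z_2} * 'S_n)%type.

Lemma root_sym (i j : 'I_n) b (v : V) : root i j b v = (-1) ^+ b * root j i b v.
Proof. by rewrite /root; case: b; rewrite ?expr0 ?expr1; ring. Qed.

(** The transposed indices are consecutive, so only the pair that they form changes its order. *)
Lemma tperm_lt (s : gen) (i j : 'I_n) : (i < j)%N ->
  ~~ ((i == lo s) && (j == hi s)) ->
  (tperm (lo s) (hi s) i < tperm (lo s) (hi s) j)%N.
Proof.
have [l h] := (loE s, hiE s); rewrite -!val_eqE /= l h.
case: (tpermP _ _ i) => [-> |-> |/eqP il /eqP ih];
  case: (tpermP _ _ j) => [-> |-> |/eqP jl /eqP jh];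
  move: il ih jl jh || idtac; move: il ih || idtac; move: jl jh || idtac;
  rewrite -?val_eqE /= ?l ?h; lia.
Qed.

(** A simple reflection permutes the positive roots other than its own. *)
Lemma chamber_refl_root s (v : V) (i j : 'I_n) b : chamber v -> (i < j)%N ->
  0 < root j i b (act (refl s) v) \/ forall u : V, root j i b u = simple s u.
Proof.
move=> cv ij; have [l h] := (loE s, hiE s).
have [/andP[/eqP ei /eqP ej]|nij] := boolP ((i == lo s) && (j == hi s)).
  (* The two coordinates of s carry two roots up to sign: its own, and an orthogonal one that the
     reflection fixes. *)
  have [eb|nb] := eqVneq b (~~ neg s).
    by right=> u; rewrite simpleE ei ej eb.
  left; have {}nb : b = neg s by move: nb; case: (b); case: (neg s).
  have := @chamber_root _ _ v (lo s) (hi s) b cv; rewrite l h ltnS leqnn => /(_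
    isT).
  rewrite /root !mxE !ffunE ei ej tpermL tpermR !eqxx orbT nb !andbT.
  by case: (neg s); rewrite /= ?expr0 ?expr1; lra.
left; have lt := tperm_lt ij nij.
have [sn|sp] := boolP (neg s); last first.
  have := chamber_root b cv lt.
  by rewrite /root !mxE !ffunE (negPf sp) /= !mul1r.
(* If [neg s] holds, then [lo s] and [hi s] are the first two indices, so j keeps its sign. A sign
   change at i exchanges the roots for [b] and [~~ b], and both are positive on the chamber. *)
have := chamber_root (~~ b) cv lt; have := chamber_root b cv lt.
rewrite /root !mxE !ffunE sn /=.
have i0 := neg_idx sn.
have jlo : j != lo s by apply: contraTneq ij => ->; rewrite l i0.
have [ejh|jh] := eqVneq j (hi s).
  move: nij; rewrite ejh eqxx andbT -val_eqE /= l i0.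
  by move: ij; rewrite ejh h i0 ltnS leqn0 => ->.
rewrite (negPf jlo) /= expr0.
by case: orb; case: b; rewrite /= ?expr0 ?expr1; lra.
Qed.

(** Geometrically, only the mirror of s separates a point of the chamber from its image; [c]
    accounts for the order of i and j. *)
Lemma chamber_refl s (v : V) (i j : 'I_n) b : chamber v -> i != j ->
  0 < root i j b v * root i j b (act (refl s) v) \/
  exists c : bool, forall u : V, root i j b u = (-1) ^+ c * simple s u.
Proof.
move=> cv; rewrite -val_eqE /= neq_ltn => /orP[] ij; last first.
  have [h|h] := chamber_refl_root s b cv ij.
    by left; rewrite mulr_gt0 // chamber_root.
  by right; exists false => u; rewrite expr0 mul1r h.
have [h|h] := chamber_refl_root s b cv ij.
  left; rewrite !(root_sym i j) mulrACA sign_sqr mul1r.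
  by rewrite mulr_gt0 // chamber_root.
by right; exists b => u; rewrite root_sym h.
Qed.

(** Both the real and the imaginary part of the base configuration. *)
Definition base : V := \row_i i.+1%:R.

Lemma chamber_base : chamber base.
Proof.
move=> s; rewrite /simple !mxE loE hiE.
case: (boolP (neg s)) => [/neg_idx ->|_]; first by rewrite expr1; lra.
by rewrite expr0 mul1r -natrB // subSn // subnn ltr01.
Qed.

Lemma chamber_generic (v : V) : chamber v -> generic v.
Proof.
move=> cv i j b; rewrite -val_eqE /= neq_ltn => /orP[] ij.
  by rewrite root_sym mulf_neq0 ?signr_eq0 // gt_eqF // chamber_root.
by rewrite gt_eqF // chamber_root.
Qed.

(** The scalar product with [base]; reflecting in a negative simple root increases it. *)
Definition height (v : V) : R := \sum_(i < n) i.+1%:R * v ord0 i.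

Lemma height_coroot s : 0 < height (coroot R s).
Proof.
suff -> : height (coroot R s) = simple s base by exact: chamber_base.
rewrite /height /simple !mxE.
have dual k : \sum_(i < n) i.+1%:R * (i == k)%:R = k.+1%:R :> R.
  rewrite (bigD1 k) //= eqxx mulr1 big1 ?addr0 // => i /negPf ->.
  by rewrite mulr0.
under eq_bigr => i _ do rewrite !mxE mulrBr mulrCA.
by rewrite sumrB -mulr_sumr !dual.
Qed.

Lemma height_refl s (v : V) :
  height (act (refl s) v) = height v - simple s v * height (coroot R s).
Proof.
rewrite act_refl /height mulr_sumr -sumrB; apply: eq_bigr => i _.
by rewrite !mxE; ring.
Qed.

Fixpoint sorts (v : V) (l : seq gen) : Prop :=
  if l is s :: l' then simple s v < 0 /\ sorts (act (refl s) v) l'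
  else chamber v.

(* The height increases at each step, and v has finitely many images. *)
Lemma sorts_ex (v : V) : generic v -> exists l, sorts v l.
Proof.
move=> gv.
(* The induction is on the number of signed permutations whose image of v is higher than the current
   one. *)
pose above (w : signed_perm) := 
  [set w' : signed_perm | height (act w v) < height (act w' v)]%SET.
suff H k w : (#|above w| <= k)%N -> exists l, sorts (act w v) l.
  by have [l] := H _ ([ffun=> 0], 1%g) (leqnn _); rewrite act_id; exists l.
elim: k w => [|k IH] w wk.
  exists [::] => s; rewrite real_ltNge ?num_real // generic_simpleP; last first.
    exact: generic_act.
  apply/negP => sv; move: wk; rewrite leqn0 cards_eq0 => /eqP/setP.
  move=> /(_ (spmul (refl s) w)); rewrite !inE act_spmul height_refl.
  by have := height_coroot s; nra.
have [[s sv]|nos] := pselect (exists s, simple s (act w v) < 0).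
  have [|l hl] := IH (spmul (refl s) w).
    rewrite -ltnS; apply: leq_trans wk; apply: proper_card.
    have h : height (act w v) < height (act (spmul (refl s) w) v).
      by rewrite act_spmul height_refl; have := height_coroot s; nra.
    apply/properP; split; first by apply/fintype.subsetP => w'; rewrite !inE;
      exact: lt_trans.
    by exists (spmul (refl s) w); rewrite !inE ?ltxx.
  by exists (s :: l); split=> //; rewrite -act_spmul.
exists [::] => s; rewrite real_ltNge ?num_real // generic_simpleP; last first.
  exact: generic_act.
by apply/negP => sv; apply: nos; exists s.
Qed.

Definition sort_act (l : seq gen) (v : V) : V :=
  foldl (fun u s => act (refl s) u) v l.

Definition word_braid (u : word gen) : BrD n := \pi_(BrD n) u.

Definition sigma (s : gen) : BrD n := word_braid [:: (s, true)].

(** The letters are multiplied in reverse, so that this braid lifts the Coxeter element by which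
    [sort_act l] acts. *)
Definition sort_braid (l : seq gen) : BrD n :=
  foldr (fun s x => x * sigma s)%g 1%g l.

End Chambers.

(** * Sorting words and transport between chambers *)

Section Sorting.
Variables (R : realType) (m : nat).
Local Notation n := m.+2.
Local Notation V := 'rV[R]_n.
Local Notation gen := (brD_gen n).
Local Notation signed_perm := ({ffun 'I_n -> 'Z_2} * 'S_n)%type.

Lemma brD_rel_eq (u v : word gen) : brD_rel u v ->
  word_braid u = word_braid v.
Proof. by move=> uv; apply/pres_piP; exact: PresRel. Qed.

Lemma brD_mulE (u v : word gen) :
  (word_braid u * word_braid v)%g = word_braid (u ++ v).
Proof. exact: pres_mulE. Qed.

Lemma sigma_braid (s t : gen) : adjacent s t ->
  (sigma s * sigma t * sigma s = sigma t * sigma s * sigma t)%g.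
Proof.
rewrite /sigma !brD_mulE /=.
case: s t => [i|] [j|] => /orP[/eqP /= e|/eqP /= e] //.
- exact: esym (brD_rel_eq (@BrDBraid n _ _ e)).
- exact: brD_rel_eq (@BrDBraid n _ _ e).
- exact: esym (brD_rel_eq (@BrDBraidS n _ (congr1 S e))).
- exact: brD_rel_eq (@BrDBraidS n _ (congr1 S e)).
Qed.

Lemma sigma_comm (s t : gen) : s != t -> ~~ adjacent s t ->
  (sigma s * sigma t = sigma t * sigma s)%g.
Proof.
rewrite /sigma !brD_mulE /=.
case: s t => [i|] [j|] //; rewrite /adjacent /=.
- move=> ij; rewrite negb_or => /andP[e e'].
  suff h : (i.+1 < j)%N \/ (j.+1 < i)%N by exact: brD_rel_eq (@BrDComm n _ _ h).
  by apply/orP; move: ij e e'; rewrite (inj_eq Some_inj) -val_eqE /=; lia.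
- move=> _ e; suff h : i.+1 <> 2%N by exact: esym (brD_rel_eq (@BrDCommS n _
    h)).
  by move=> -[e1]; rewrite e1 in e.
- move=> _ e; suff h : j.+1 <> 2%N by exact: brD_rel_eq (@BrDCommS n _ h).
  by move=> -[e1]; rewrite e1 in e.
Qed.

(** An induction on the length reduces this to local confluence: when two simple roots are negative
    at v, both words can be traded for the two sides of a defining relation followed by a common
    tail. *)
Lemma sorts_confluent k (v : V) l l' : generic v -> size l = k ->
  sorts v l -> sorts v l' ->
  [/\ size l' = k, sort_braid l' = sort_braid l &
      forall u : V, sort_act l' u = sort_act l u].
Proof.
elim: k v l l' => [|k IH] v [|s l] [|t l'] // gv.
- by move=> _ /(_ t) tv [/= ]; rewrite ltNge ltW.
- by move=> _ [sv _] /(_ s); rewrite ltNge ltW.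
move=> [sl] [sv hl] [tv hl'].
have gs := generic_act (refl s) gv; have gt := generic_act (refl t) gv.
have [est|st] := eqVneq s t.
  rewrite -{}est in hl' *; have [/= -> -> e] := IH _ _ _ gs sl hl hl'.
  by split=> // u; rewrite /sort_act /= -!/(sort_act _ _) e.
have [ad|nad] := boolP (adjacent s t).
  have ad' : adjacent t s by rewrite adjacent_sym.
  (* The common tail [p] sorts the image of v under sts = tst. *)
  have [p hp] := sorts_ex (generic_act (refl s) (generic_act (refl t) gs)).
  have [|/= [sp] bp ap] := IH _ _ [:: t, s & p] gs sl hl.
    split; first by rewrite simple_refl_braid //; lra.
    by split=> //; rewrite simple_refl_braid // simple_refl simple_refl_braid
      //; lra.
  have [||/= sl' bl' al'] := IH _ [:: s, t & p] _ gt _ _ hl'.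
  - by rewrite /= sp.
  - split; first by rewrite simple_refl_braid //; lra.
    split; first by rewrite simple_refl_braid // simple_refl simple_refl_braid
      //; lra.
    by rewrite -act_refl_braid.
  rewrite /= sl'; split=> // [|u].
    by rewrite bl' -bp -!mulgA [X in (_ * X)%g]mulgA sigma_braid // !mulgA.
  rewrite /sort_act /= -!/(sort_act _ _) al' -ap.
  by rewrite /sort_act /= act_refl_braid.
have nad' : ~~ adjacent t s by rewrite adjacent_sym.
have ts : t != s by rewrite eq_sym.
have [p hp] := sorts_ex (generic_act (refl t) gs).
have [|/= sp bp ap] := IH _ _ [:: t & p] gs sl hl.
  by split; rewrite ?simple_refl_comm.
have [||/= sl' bl' al'] := IH _ [:: s & p] _ gt _ _ hl'.
- by rewrite /= sp.
- by split; rewrite ?simple_refl_comm // act_refl_comm.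
rewrite /= sl'; split=> // [|u].
  by rewrite bl' -bp -!mulgA sigma_comm.
rewrite /sort_act /= -!/(sort_act _ _) al' -ap.
by rewrite /sort_act /= act_refl_comm.
Qed.

Definition sort (v : V) : seq gen := xget [::] (sorts v).

Lemma sortP v : generic v -> sorts v (sort v).
Proof. by move=> /sorts_ex[l hl]; exact: xgetI hl. Qed.

(** This is the element written T in the sketch of the proof. *)
Definition lift (v : V) : BrD n := sort_braid (sort v).

(** By confluence, a sorting word may be taken to begin with any simple root that is negative at
    v. *)
Lemma sort_cons s (v : V) : generic v -> simple s v < 0 ->
  lift v = (lift (act (refl s) v) * sigma s)%g /\
  forall u : V, sort_act (sort v) u =
    sort_act (sort (act (refl s) v)) (act (refl s) u).
Proof.
move=> gv sv; have gs := generic_act (refl s) gv.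
have [|_ b a] := sorts_confluent gv (erefl _) (sortP gv)
  (_ : sorts v (s :: sort (act (refl s) v))).
  by split=> //; exact: sortP.
by split=> // u; rewrite -a.
Qed.

Lemma lift_refl s (v : V) : generic v -> 0 < simple s v ->
  lift (act (refl s) v) = (lift v * sigma s)%g.
Proof.
move=> gv sv; have gs := generic_act (refl s) gv.
have [|-> _] := sort_cons (s := s) gs.
  by rewrite simple_refl oppr_lt0.
by rewrite act_reflK.
Qed.

Lemma sort_chamber (v : V) : chamber v -> sort v = [::].
Proof.
move=> cv; have := sortP (chamber_generic cv).
by case: (sort v) => // s l [] /=; rewrite ltNge ltW.
Qed.

(** Whichever of x and its mirror image lies on the negative side of s has a sorting word that
    begins with s, so the elements sorting the two points differ by this reflection. *)
Lemma sort_act_refl s (x u : V) : generic x ->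
  sort_act (sort (act (refl s) x)) (act (refl s) u) = sort_act (sort x) u.
Proof.
move=> gx; case: (ltrgt0P (simple s x)) => sx.
- have gs := generic_act (refl s) gx.
  have [|_ ->] := sort_cons (s := s) gs; last by rewrite !act_reflK.
  by rewrite simple_refl oppr_lt0.
- by have [_ ->] := sort_cons gx sx.
- by have := generic_simple s gx; rewrite sx eqxx.
Qed.

(** This is T(w y) for the element w that moves x into the fundamental chamber. *)
Definition potential (x y : V) : BrD n := lift (sort_act (sort x) y).

Lemma potential_refl s (x y : V) : generic x ->
  potential (act (refl s) x) (act (refl s) y) = potential x y.
Proof. by move=> gx; rewrite /potential sort_act_refl. Qed.

Definition transport (y x x' : V) : BrD n :=
  ((potential x y)^-1 * potential x' y)%g.

Definition separated_agree (x x' y y' : V) : Prop := forall i j b, i != j ->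
  root i j b x * root i j b x' < 0 -> 0 < root i j b y * root i j b y'.

Lemma separated_agree_act w x x' y y' : separated_agree x x' y y' ->
  separated_agree (act w x) (act w x') (act w y) (act w y').
Proof.
move=> h i j b ij; have [b' e] := root_act2 R w i j b; rewrite !e.
by apply: h; rewrite (inj_eq perm_inj).
Qed.

Lemma mulss_gt0 (a : R) : a != 0 -> 0 < a * a.
Proof. by move=> nz; rewrite -expr2 exprn_even_gt0. Qed.

Lemma mul_sign_lt0 (a b c : R) : 0 < a * b -> a * c < 0 -> b * c < 0.
Proof.
move=> ab ac; have : (a * b) * (a * c) < 0 by rewrite pmulr_rlt0.
rewrite mulrACA pmulr_rlt0 // mulss_gt0 //.
by apply: contraTneq ab => ->; rewrite mul0r ltxx.
Qed.

(* A gallery from x to x' only crosses walls that separate them, and each crossing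
   contributes sigma s or its inverse according to the sign at y of the root. *)
Lemma transport_agree (x x' y y' : V) :
  generic x -> generic x' -> generic y -> generic y' ->
  separated_agree x x' y y' -> transport y x x' = transport y' x x'.
Proof.
(* The outer induction moves x into the chamber, using the invariance of the potential; once it is
   there, the inner induction shortens a sorting word of x'. *)
move=> gx; move: (sortP gx); move: (sort x) => l0; elim: l0 x gx x' y y' => [|s
  l IH] x gx x' y y'.
  move=> /= cx gx'; move: (sortP gx').
  move: (sort x') => l0; elim: l0 x' gx' y y' => [|s l IH] x' gx' y y' /=.
    move=> cx' _ _ _.
    by rewrite /transport /potential !sort_chamber //= !mulVg.
  move=> [sx' hl] gy gy' h.
  have gs := generic_act (refl s) gx'.
  (* The wall of s separates x, which is in the chamber, from x'; so y and y' lie on the same side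
     of it. *)
  have ssgn : 0 < simple s y * simple s y'.
    rewrite !simpleE; apply: h; first by rewrite eq_sym lo_hi.
    by rewrite -!simpleE; have := cx s; nra.
  have := IH _ gs _ _ hl (generic_act (refl s) gy) (generic_act (refl s) gy').
  rewrite /transport /potential !sort_act_refl // (sort_chamber cx) /=.
  set z := lift (sort_act (sort x') y); set z' := lift (sort_act (sort x') y')
    => IHs.
  have {}IHs : ((lift (act (refl s) y))^-1 * z =
             (lift (act (refl s) y'))^-1 * z')%g.
    apply: IHs => i j b ij.
    (* The wall of s does not separate x from the reflected x'. Any other wall has x and its mirror
       image on one side, so if it separates x from the reflected x', its mirror image separates x
       from x'. *)
    have [p|[c e]] := chamber_refl s b cx ij; last first.
      rewrite !e mulrACA sign_sqr mul1r simple_refl pmulr_rlt0 ?cx //.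
      by rewrite oppr_lt0 ltNge (ltW sx').
    have [b' e] := root_act2 R (refl s) i j b; rewrite e => sep.
    apply: h; first by rewrite (inj_eq perm_inj).
    by rewrite -e; exact: mul_sign_lt0 p sep.
  (* Crossing the wall of s contributes [sigma s] or its inverse, the same for y and y' as they lie
     on one side. *)
  have : ((lift y)^-1 * lift (act (refl s) y) =
          (lift y')^-1 * lift (act (refl s) y'))%g.
    case: (ltrgt0P (simple s y)) ssgn => sy; last by rewrite sy mul0r ltxx.
      by rewrite pmulr_rgt0 // => sy'; rewrite !lift_refl // !mulKg.
    rewrite nmulr_rgt0 // => sy'.
    have [-> _] := sort_cons gy sy.
    have [-> _] := sort_cons gy' sy'.
    by rewrite !invMg !mulgVK.
  clearbody z z'; move=> e; rewrite -[z](mulVKg (lift (act (refl s) y))) IHs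
    mulgA e.
  by rewrite -mulgA mulVKg.
move=> /= [sx hl] gx' gy gy' h.
rewrite /transport -!(potential_refl s _ gx) -!(potential_refl s _ gx').
by apply: IH; do ?exact: generic_act; do ?exact: separated_agree_act.
Qed.

End Sorting.

(** * Holonomy of sequences of generic points *)

Section Holonomy.
Variables (R : realType) (m : nat).
Local Notation n := m.+2.
Local Notation V := 'rV[R]_n.
Local Notation gen := (brD_gen n).
Local Notation signed_perm := ({ffun 'I_n -> 'Z_2} * 'S_n)%type.

(** The point v lies in the closure of the face that contains v'. *)
Definition sign_extends (v v' : V) : Prop := forall i j b, i != j ->
  root i j b v != 0 -> 0 < root i j b v * root i j b v'.

Lemma mul_gt0_neq0 (a b : R) : 0 < a * b -> b != 0.
Proof. by apply: contraTneq => ->; rewrite mulr0 ltxx. Qed.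

Lemma mul_sign_trans (a b c : R) : 0 < a * b -> 0 < b * c -> 0 < a * c.
Proof.
move=> ab bc; have b2 : 0 < b * b.
  exact/mulss_gt0/mul_gt0_neq0/ab.
rewrite -(pmulr_rgt0 _ b2) (_ : b * b * (a * c) = a * b * (b * c)); last by
  ring.
exact: mulr_gt0.
Qed.

Lemma sign_extends_refl v : sign_extends v v.
Proof. by move=> i j b _; exact: mulss_gt0. Qed.

Lemma sign_extends_trans v1 v2 v3 :
  sign_extends v1 v2 -> sign_extends v2 v3 -> sign_extends v1 v3.
Proof.
move=> h1 h2 i j b ij nz; have h := h1 _ _ _ ij nz.
exact: mul_sign_trans h (h2 _ _ _ ij (mul_gt0_neq0 h)).
Qed.

Lemma sign_extends_act w v v' :
  sign_extends v v' -> sign_extends (act w v) (act w v').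
Proof.
move=> h i j b ij; have [c e] := root_act R w i j b.
rewrite !e mulrACA sign_sqr mul1r => nz; apply: h.
  by rewrite (inj_eq perm_inj).
by apply: contra nz => /eqP ->; rewrite mulr0.
Qed.

Lemma pos_below (s : seq R) :
  exists2 k : R, 0 < k & forall x, x \in s -> 0 < x -> k < x.
Proof.
elim: s => [|x s [k k0 hk]]; first by exists 1.
have [x0|x0] := ltP 0 x; last first.
  exists k => // y; rewrite inE => /orP[/eqP ->|]; last exact: hk.
  by rewrite ltNge x0.
exists (Num.min k (x / 2)); first by rewrite lt_min k0 divr_gt0.
move=> y; rewrite inE gt_min => /orP[/eqP -> _|ys y0]; last by rewrite hk.
by apply/orP; right; lra.
Qed.

(** A small multiple of [base] is added: no root vanishes on [base], and the signs of the roots that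
    are nonzero at v persist. *)
Lemma generic_near v : exists v', generic v' /\ sign_extends v v'.
Proof.
have gb := chamber_generic (@chamber_base R m).
(* Adding 1 keeps the denominators positive; the enumeration includes the pairs i = j, where [root]
   may vanish at [base]. *)
pose s := [seq `|root t.1.1 t.1.2 t.2 v| / (1 + `|root t.1.1 t.1.2 t.2 (base R
  m)|) |
             t <- enum {: 'I_n * 'I_n * bool}].
have [k k0 hk] := pos_below s.
have D i j b : root i j b (v + k *: base R m) = root i j b v + k * root i j b
  (base R m).
  by rewrite /root !mxE; ring.
have ext : sign_extends v (v + k *: base R m).
  move=> i j b ij nz; rewrite D.
  have : `|k * root i j b (base R m)| < `|root i j b v|.
    rewrite normrM gtr0_norm // (le_lt_trans (y := k * (1 + `|root i j b (base R
      m)|))) //.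
      by rewrite ler_pM2l // lerDr.
    rewrite -ltr_pdivlMr ?ltr_pwDl //; apply: hk.
      by apply/mapP; exists (i, j, b); rewrite // mem_enum.
    by rewrite divr_gt0 ?normr_gt0 // ltr_pwDl.
  set a := root i j b v in nz *; set e := k * _.
  have [a0|a0|a0] := ltrgt0P a; last by rewrite a0 eqxx in nz.
    by rewrite ltr_norml => /andP[h1 h2]; nra.
  by rewrite ltr_norml => /andP[h1 h2]; nra.
exists (v + k *: base R m); split=> // i j b ij.
have [z|nz] := eqVneq (root i j b v) 0; last exact: mul_gt0_neq0 (ext _ _ _ ij
  nz).
by rewrite D z add0r; apply: mulf_neq0; [rewrite gt_eqF|exact: gb].
Qed.

(** The last clause keeps generic points fixed, so that sampling does not perturb generic end points
    of paths. *)
Definition generify v : V :=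
  xget v [set v' | [/\ generic v', sign_extends v v' & generic v -> v' = v]].

Lemma generifyP v : [/\ generic (generify v), sign_extends v (generify v) &
  generic v -> generify v = v].
Proof.
apply: (@xgetPex _ v
  [set v' | [/\ generic v', sign_extends v v' & generic v -> v' = v]]) => /=.
have [gv|ngv] := pselect (generic v).
  by exists v; split=> //; exact: sign_extends_refl.
by have [v' []] := generic_near v; exists v'; split.
Qed.

(** Only a move of the real part contributes, measured with the imaginary part of p. *)
Definition step (p q : V * V) : BrD n := transport p.2 p.1 q.1.

Lemma stepxx p : step p p = 1%g.
Proof. by rewrite /step /transport mulVg. Qed.

Definition nondegenerate (z : V * V) : Prop := forall i j b, i != j ->
  root i j b z.1 != 0 \/ root i j b z.2 != 0.

(* The generic pairs in chambers adjacent to the faces of x and y.  A wall that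
   separates two real parts in the star passes through x; if (x, y) is
   nondegenerate, it avoids y and does not separate the imaginary parts. *)
Definition star (z p : V * V) : Prop :=
  [/\ generic p.1, generic p.2, sign_extends z.1 p.1 & sign_extends z.2 p.2].

(** For a fixed imaginary part, [transport] telescopes. Inside a star, [q.2] may be replaced by
    [p.2], as no wall separates both the real parts and the imaginary parts. *)
Lemma step_cocycle z p q r : nondegenerate z -> star z p -> star z q ->
  star z r -> (step p q * step q r = step p r)%g.
Proof.
move=> nz [gp1 gp2 ep1 ep2] [gq1 gq2 eq1 eq2] [gr1 gr2 er1 er2].
rewrite /step (_ : transport q.2 q.1 r.1 = transport p.2 q.1 r.1).
  by rewrite /transport -mulgA mulVKg.
apply: transport_agree => // i j b ij sep.
have [h|h] := nz i j b ij; last first.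
  by apply: mul_sign_trans (ep2 _ _ _ ij h); rewrite mulrC; exact: eq2.
have h1 := eq1 _ _ _ ij h; have h2 := er1 _ _ _ ij h.
rewrite mulrC in h1; have := mul_sign_trans h1 h2.
by rewrite ltNge (ltW sep).
Qed.

Fixpoint holonomy (p : nat -> V * V) (N : nat) : BrD n :=
  if N is k.+1 then (holonomy p k * step (p k) (p k.+1))%g else 1%g.

Lemma eq_holonomy p q N : (forall k, (k <= N)%N -> p k = q k) ->
  holonomy p N = holonomy q N.
Proof.
elim: N => //= N IH e; rewrite !e // IH // => k kN.
by apply: e; exact: leqW.
Qed.

Lemma holonomy_cat p M N :
  holonomy p (M + N) = (holonomy p M * holonomy (fun k => p (M + k)%N) N)%g.
Proof.
elim: N => [|N IH] /=; first by rewrite addn0 mulg1.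
by rewrite addnS /= IH -mulgA.
Qed.

(** The two sequences form a ladder; each of its squares lies in one star, where both ways around
    agree, and the inner rungs cancel. *)
Lemma holonomy_square p q N :
  (forall k, (k < N)%N -> exists z, nondegenerate z /\
    [/\ star z (p k), star z (p k.+1), star z (q k) & star z (q k.+1)]) ->
  (holonomy p N * step (p N) (q N) = step (p 0) (q 0) * holonomy q N)%g.
Proof.
elim: N => [|N IH] h /=; first by rewrite mulg1 mul1g.
have [z [nz [pk pk1 qk qk1]]] := h N (ltnSn N).
rewrite [RHS]mulgA -IH; last by move=> k kN; apply: h; exact: leqW.
by rewrite -[LHS]mulgA -[RHS]mulgA (step_cocycle nz pk pk1 qk1) (step_cocycle nz
  pk qk qk1).
Qed.

Lemma holonomy_star z p N : nondegenerate z ->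
  (forall k, (k <= N)%N -> star z (p k)) -> holonomy p N = step (p 0) (p N).
Proof.
move=> nz; elim: N => [|N IH] h /=; first by rewrite stepxx.
rewrite IH; last by move=> k kN; apply: h; exact: leqW.
by rewrite (step_cocycle nz) //; apply: h.
Qed.

Lemma holonomy_double p N :
  (forall k, (k < N)%N -> exists z, nondegenerate z /\
    [/\ star z (p k.*2), star z (p k.*2.+1) & star z (p k.*2.+2)]) ->
  holonomy p N.*2 = holonomy (fun k => p k.*2) N.
Proof.
elim: N => //= N IH h; rewrite IH; last by move=> k kN; apply: h; exact: leqW.
have [z [nz [h1 h2 h3]]] := h N (ltnSn N).
by rewrite -mulgA (step_cocycle nz h1 h2 h3).
Qed.

(** It stands in for membership in the Coxeter group of type D_n: the simple reflections have it,
    and it passes to products and inverses. *)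
Definition invariant (w : signed_perm) : Prop := forall x y : V,
  generic x -> potential (act w x) (act w y) = potential x y.

Lemma invariant_refl s : invariant (refl s).
Proof. by move=> x y; exact: potential_refl. Qed.

Lemma invariant_mul w w' : invariant w -> invariant w' -> invariant (spmul w
    w').
Proof.
move=> h h' x y gx; rewrite !act_spmul h ?h' //; exact: generic_act.
Qed.

Lemma invariant_inv w : invariant w -> invariant (spinv w).
Proof.
move=> h x y gx; rewrite -[in RHS](act_spinvK w x) -[in RHS](act_spinvK w y).
by rewrite h //; exact: generic_act.
Qed.

Lemma invariant_id : invariant ([ffun=> 0], 1%g).
Proof. by move=> x y _; rewrite !act_id. Qed.

Definition act2 w (p : V * V) : V * V := (act w p.1, act w p.2).

Lemma step_act w p q : invariant w -> generic p.1 -> generic q.1 ->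
  step (act2 w p) (act2 w q) = step p q.
Proof. by move=> h gp gq; rewrite /step /transport /= !h. Qed.

Lemma star_act w z p : star z p -> star (act2 w z) (act2 w p).
Proof.
by case=> *; split=> /=; do ?exact: generic_act; exact: sign_extends_act.
Qed.

End Holonomy.

(** * Real and imaginary parts of configurations *)

Section Parts.
Variables (R : realType) (m : nat).
Local Notation n := m.+2.
Local Notation V := 'rV[R]_n.
Local Notation gen := (brD_gen n).
Local Notation signed_perm := ({ffun 'I_n -> 'Z_2} * 'S_n)%type.
Local Notation C := (R[i]^o).
Local Notation conf := 'rV[C]_n.
Local Notation I := [set` `[(0 : R), (1 : R)]].

Lemma complex_norm_re (z : C) : (`|complex.Re z|%:C <= `|z| :> R[i]).
Proof.
case: z => a b; rewrite normc_def /= lecR.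
by rewrite -sqrtr_sqr ler_wsqrtr // lerDl sqr_ge0.
Qed.

Lemma complex_norm_im (z : C) : (`|complex.Im z|%:C <= `|z| :> R[i]).
Proof.
case: z => a b; rewrite normc_def /= lecR.
by rewrite -sqrtr_sqr ler_wsqrtr // lerDr sqr_ge0.
Qed.

Lemma continuous_re : continuous (fun z : C => complex.Re z).
Proof.
move=> z A /nbhs_ballP[e /= e0 eA]; apply/nbhs_ballP.
exists e%:C; rewrite /= ?ltcR // => y zy; apply: eA.
rewrite /ball /= -raddfB -ltcR; apply: le_lt_trans zy.
exact: (complex_norm_re (z - y)).
Qed.

Lemma continuous_im : continuous (fun z : C => complex.Im z).
Proof.
move=> z A /nbhs_ballP[e /= e0 eA]; apply/nbhs_ballP.
exists e%:C; rewrite /= ?ltcR // => y zy; apply: eA.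
rewrite /ball /= -raddfB -ltcR; apply: le_lt_trans zy.
exact: (complex_norm_im (z - y)).
Qed.

Lemma continuous_complex (T : topologicalType) (f g : T -> R) :
  continuous f -> continuous g -> continuous (fun x => f x +i* g x : C).
Proof.
have cR : continuous (fun x : R => x%:C : C).
  move=> x A /nbhs_ballP[e /= e0 eA]; apply/nbhs_ballP.
  have [a ea] : exists a, e = a%:C.
    by exists (complex.Re e); rewrite RRe_real // ger0_real // ltW.
  move: e0 eA; rewrite ea ltcR => a0 eA; exists a => //= y xy; apply: eA.
  by rewrite /ball /= -rmorphB /= normc_def /= expr0n addr0 sqrtr_sqr ltcR.
move=> cf cg; rewrite (_ : (fun x => _) = (fun x => (f x)%:C + 'i * (g x)%:C :
  C)).
  move=> x; apply: cvgD.
    by apply: continuous_comp; [exact: cf|exact: cR].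
  apply: cvgM; first exact: cvg_cst.
  by apply: continuous_comp; [exact: cg|exact: cR].
by apply/funext => x; apply/eqP; rewrite eq_complex /= ; apply/andP; split;
  apply/eqP; ring.
Qed.

Definition repart (z : conf) : V := \row_i complex.Re (z ord0 i).
Definition impart (z : conf) : V := \row_i complex.Im (z ord0 i).
Definition parts (z : conf) : V * V := (repart z, impart z).

Definition conf_of (p : V * V) : conf := \row_i (p.1 ord0 i +i* p.2 ord0 i).

Lemma parts_conf_of p : parts (conf_of p) = p.
Proof. by case: p => x y; congr (_, _); apply/rv_eq => i; rewrite !mxE. Qed.

Lemma conf_of_parts z : conf_of (parts z) = z.
Proof. by apply/rv_eq => i; rewrite !mxE; case: (z ord0 i). Qed.

Lemma re_sign k (z : C) : complex.Re ((-1) ^+ k * z) = (-1) ^+ k * complex.Re z.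
Proof.
rewrite -signr_odd -[in RHS]signr_odd.
by case: odd; rewrite ?expr0 ?expr1 ?mul1r // !mulN1r raddfN.
Qed.

Lemma im_sign k (z : C) : complex.Im ((-1) ^+ k * z) = (-1) ^+ k * complex.Im z.
Proof.
rewrite -signr_odd -[in RHS]signr_odd.
by case: odd; rewrite ?expr0 ?expr1 ?mul1r // !mulN1r raddfN.
Qed.

Lemma parts_twist w z : parts (twist w.1 w.2 z) = act2 w (parts z).
Proof.
by congr (_, _); apply/rv_eq => i; rewrite !mxE /Z2act ?re_sign ?im_sign.
Qed.

Lemma conf_of_act2 w p : conf_of (act2 w p) = twist w.1 w.2 (conf_of p).
Proof. by rewrite -[RHS]conf_of_parts parts_twist parts_conf_of. Qed.

(** The roots have real coefficients, so one vanishes at z exactly when it vanishes on both parts;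
    and z_i = z_j or z_i = -z_j is the vanishing of one of the two roots on i and j. *)
Lemma orbit_conf_nondegenerate z : orbit_conf z <-> nondegenerate (parts z).
Proof.
split=> [/orbit_confP Fz i j b ij|nz].
  apply/orP; rewrite -negb_and; apply/negP => /andP[/eqP r0 /eqP i0].
  apply: (Fz i j ij (if b then 0 else 1)); move: r0 i0.
  rewrite /root /Z2act !mxE; case: (z ord0 i) => a c; case: (z ord0 j) => a' c'.
  by case: b; rewrite /= ?expr0 ?expr1 ?mul1r ?mulN1r => h h';
    apply/eqP; rewrite eq_complex /=; apply/andP; split; apply/eqP; lra.
apply/orbit_confP => i j ij h e.
suff [b [r0 i0]] : exists b, root i j b (repart z) = 0 /\ root i j b (impart z)
  = 0.
  by have [] := nz i j b ij; rewrite /parts /= ?r0 ?i0 eqxx.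
exists (~~ odd h); move: e; rewrite /root /Z2act !mxE => ->.
rewrite -signr_odd; case: odd; rewrite /= ?expr0 ?expr1 ?mul1r ?mulN1r ?raddfN
  /=.
  by split; ring.
by split; ring.
Qed.

Definition gparts (z : conf) : V * V := (generify (repart z), generify (impart
    z)).

Definition adherent (z z' : conf) : Prop :=
  sign_extends (repart z) (repart z') /\ sign_extends (impart z) (impart z').

Lemma star_gparts z z' : adherent z z' -> star (parts z) (gparts z').
Proof.
move=> [hr hi]; have [g1 e1 _] := generifyP (repart z').
have [g2 e2 _] := generifyP (impart z').
by split=> //=; [exact: sign_extends_trans hr e1|exact: sign_extends_trans hi
  e2].
Qed.

Lemma gparts_generic z : generic (repart z) -> generic (impart z) ->
  gparts z = parts z.
Proof.
move=> gr gi; have [_ _ /(_ gr) e1] := generifyP (repart z).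
by have [_ _ /(_ gi) e2] := generifyP (impart z); rewrite /gparts e1 e2.
Qed.

(** Finitely many roots are involved, and a nonzero value keeps its sign nearby. *)
Lemma sign_extends_near (T : topologicalType) (f : T -> V) (x : T) :
  (forall i, {for x, continuous (fun y => f y ord0 i)}) ->
  \forall y \near x, sign_extends (f x) (f y).
Proof.
move=> cf.
suff h : \forall y \near x, forall t : 'I_n * 'I_n * bool,
   root t.1.1 t.1.2 t.2 (f x) != 0 ->
   0 < root t.1.1 t.1.2 t.2 (f x) * root t.1.1 t.1.2 t.2 (f y).
  by apply: filterS h => y h i j b ij; exact: (h (i, j, b)).
apply: filter_forall => -[[i j] b] /=.
have [->|nz] := eqVneq (root i j b (f x)) 0.
  by apply: nearW.
have c : (fun y => root i j b (f x) * root i j b (f y)) @ x -->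
   (root i j b (f x) * root i j b (f x)).
  apply: cvgM; first exact: cvg_cst.
  by apply: cvgD; [exact: cf|apply: cvgM; [exact: cvg_cst|exact: cf]].
have p : 0 < root i j b (f x) * root i j b (f x) by exact: mulss_gt0.
by near=> y => _; near: y; exact: (cvgr_gt _ c).
Unshelve. all: by end_near. Qed.

Lemma adherent_near z : \forall z' \near z, adherent z z'.
Proof.
have cid : continuous (fun z : conf => z) by move=> ?; exact: cvg_id.
apply: filterI.
- apply: (@sign_extends_near conf repart z) => i.
  rewrite (_ : (fun y => _) = (fun z : C => complex.Re z) \o (fun y : conf => y
    ord0 i : C)).
    apply: continuous_comp; last exact: continuous_re.
    exact: (@conf_coord_continuous R n _ _ i cid).
  by apply/funext => y /=; rewrite mxE.
- apply: (@sign_extends_near conf impart z) => i.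
  rewrite (_ : (fun y => _) = (fun z : C => complex.Im z) \o (fun y : conf => y
    ord0 i : C)).
    apply: continuous_comp; last exact: continuous_im.
    exact: (@conf_coord_continuous R n _ _ i cid).
  by apply/funext => y /=; rewrite mxE.
Qed.

End Parts.

(** * Holonomy of paths *)

Section PathHolonomy.
Variables (R : realType) (m : nat).
Local Notation n := m.+2.
Local Notation V := 'rV[R]_n.
Local Notation gen := (brD_gen n).
Local Notation signed_perm := ({ffun 'I_n -> 'Z_2} * 'S_n)%type.
Local Notation C := (R[i]^o).
Local Notation conf := 'rV[C]_n.
Local Notation I := [set` `[(0 : R), (1 : R)]].

(** A Lebesgue number argument: near x the configuration [H x] serves as centre, and compactness of
    the square makes the scale uniform. *)
Lemma fine_grid (H : R * R -> conf) :
  {within I `*` I, continuous H} ->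
  (forall t u, I t -> I u -> orbit_conf (H (t, u))) ->
  exists K0, forall K, (K0 <= K)%N -> forall x, (I `*` I) x ->
  exists z, orbit_conf z /\ forall x', (I `*` I) x' ->
    `|x'.1 - x.1| <= 2 ^- K -> `|x'.2 - x.2| <= 2 ^- K -> adherent z (H x').
Proof.
move=> /subspace_continuousP cH FH.
have := compact_setX (@segment_compact R 0 1) (@segment_compact R 0 1).
move=> /compact_near_coveringP.
pose P (K : nat) (x : R * R) := exists z, orbit_conf z /\
  forall x', (I `*` I) x' -> `|x'.1 - x.1| <= 2 ^- K ->
  `|x'.2 - x.2| <= 2 ^- K -> adherent z (H x').
move=> /(_ nat (nbhs \oo) P _) [x Ix|K0 _ hK0]; last first.
  by exists K0 => K KK0 x Ix; exact: hK0 KK0 x Ix.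
have := cH x Ix _ (adherent_near (H x)); rewrite /within /= nbhs_simpl /=.
move=> /nbhs_ballP[e /= e0 he].
have nz : orbit_conf (H x).
  by case: x Ix {he} => t u [] *; exact: FH.
have e2 : 0 < e / 2 by rewrite divr_gt0.
(* Half of the radius allows for the distance from x to x', the other half for the mesh. *)
exists (ball x (e / 2), [set K | (Num.bound (e / 2)^-1 <= K)%N]).
  split=> /=; first exact: nbhsx_ballx.
  by exists (Num.bound (e / 2)^-1).
move=> [x' K] /= [[b1 b2] hK]; exists (H x); split=> // y Iy h1 h2.
have small : 2 ^- K <= e / 2.
  rewrite -[leRHS]invrK lef_pV2 ?posrE ?exprn_gt0 ?invr_gt0 //.
  have := archi_boundP (ltW (_ : 0 < (e / 2)^-1)); rewrite invr_gt0 => /(_ e2)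
    h.
  apply/ltW/(lt_le_trans h); rewrite -natrX ler_nat.
  exact: leq_trans hK (ltnW (ltn_expl _ _)).
apply: he => //; split=> /=.
  rewrite /ball /=; have := b1; rewrite /ball /=.
  have := ler_distD x'.1 x.1 y.1; rewrite (distrC x'.1 y.1); lra.
rewrite /ball /=; have := b2; rewrite /ball /=.
have := ler_distD x'.2 x.2 y.2; rewrite (distrC x'.2 y.2); lra.
Qed.

Definition grid (K k : nat) : R := k%:R / 2 ^+ K.

Lemma pow2_gt0 K : 0 < 2 ^+ K :> R.
Proof. by rewrite exprn_gt0. Qed.

Lemma grid_itv K k : (k <= 2 ^ K)%N -> I (grid K k).
Proof.
move=> h; apply/itv01P/andP; split; rewrite /grid.
  by rewrite divr_ge0 ?ler0n // ltW ?pow2_gt0.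
by rewrite ler_pdivrMr ?pow2_gt0 // mul1r -natrX ler_nat.
Qed.

Lemma grid0 K : grid K 0 = 0. Proof. by rewrite /grid mul0r. Qed.

Lemma grid1 K : grid K (2 ^ K) = 1.
Proof. by rewrite /grid natrX divff // gt_eqF ?pow2_gt0. Qed.

Lemma gridS K k : grid K k.+1 = grid K k + 2 ^- K.
Proof. by rewrite /grid -natr1 mulrDl mul1r. Qed.

Lemma grid_double K k : grid K.+1 k.*2 = grid K k.
Proof.
rewrite /grid -muln2 natrM exprSr; have := pow2_gt0 K => ?.
by field; rewrite gt_eqF.
Qed.

Lemma pow2_inv_ge0 K : 0 <= 2 ^- K :> R.
Proof. by rewrite invr_ge0 ltW ?pow2_gt0. Qed.

Definition sample (a : R -> conf) (K k : nat) : V * V := gparts (a (grid K k)).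

Definition hol (a : R -> conf) (K : nat) : BrD n :=
  holonomy (sample a K) (2 ^ K).

(** The common value on all fine dyadic subdivisions; it is a relation, since an arbitrary function
    need not have such a value. *)
Definition has_holonomy (a : R -> conf) (h : BrD n) : Prop :=
  exists K0, forall K, (K0 <= K)%N -> hol a K = h.

Lemma has_holonomy_uniq a h h' : has_holonomy a h -> has_holonomy a h' -> h =
    h'.
Proof.
move=> [K e] [K' e']; rewrite -(e (maxn K K')) ?leq_maxl //.
by rewrite e' ?leq_maxr.
Qed.

Lemma fine_grid_path (a : R -> conf) : orbit_path a ->
  exists K0, forall K, (K0 <= K)%N -> forall t, I t ->
  exists z, orbit_conf z /\ forall t', I t' ->
    `|t' - t| <= 2 ^- K -> adherent z (a t').
Proof.
move=> [ca Fa]; have [||K0 hK0] := @fine_grid (a \o fst).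
- apply: (within_comp _ _ ca); last by move=> x [].
  by apply: continuous_subspaceT => x; exact: cvg_fst.
- by move=> t u It _; exact: Fa.
exists K0 => K KK t It; have [//|z [nz hz]] := hK0 K KK (t, 0).
  by split=> //=; exact: I0.
exists z; split=> // t' It' tt'; apply: (hz (t', 0)) => //=.
  by split=> //=; exact: I0.
by rewrite subrr normr0 pow2_inv_ge0.
Qed.

(** On a fine mesh, halving inserts a point into a step without leaving a star, so the product does
    not change. *)
Lemma has_holonomy_ex a : orbit_path a -> exists h, has_holonomy a h.
Proof.
move=> /fine_grid_path[K0 hK0]; exists (hol a K0), K0.
suff st K : (K0 <= K)%N -> hol a K.+1 = hol a K.
  by elim=> [|K IH]; [rewrite leqn0 => /eqP <-|rewrite leq_eqVlt => /predU1P[<-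
    //|h];
     rewrite st // IH].
move=> KK; rewrite /hol expnS mul2n holonomy_double => [|k kN].
  by apply: eq_holonomy => k _; rewrite /sample grid_double.
(* The star is chosen around the inserted odd point, whose two neighbours are within one mesh
   width. *)
have [|z [nz hz]] := hK0 K.+1 (leqW KK) (grid K.+1 k.*2.+1).
  by apply: grid_itv; rewrite expnS mul2n ltn_double.
have kd : (k.*2.+2 <= 2 ^ K.+1)%N by rewrite expnS mul2n -doubleS leq_double.
exists (parts z); split; first exact/orbit_conf_nondegenerate.
split; apply: star_gparts; apply: hz.
- by apply: grid_itv; apply: leq_trans kd; exact: leqW (leqnSn _).
- by rewrite gridS opprD addNKr normrN ger0_norm // pow2_inv_ge0.
- by apply: grid_itv; exact: ltnW.
- by rewrite subrr normr0 pow2_inv_ge0.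
- exact: grid_itv.
- by rewrite [grid _ k.*2.+2]gridS addrC addKr ger0_norm // pow2_inv_ge0.
Qed.

Lemma has_holonomy_concat a b h k : a 1 = b 0 ->
  has_holonomy a h -> has_holonomy b k -> has_holonomy (concat a b) (h * k)%g.
Proof.
(* Level K + 1 of the concatenation consists of level K of each half. *)
move=> ab [K0 ha] [K1 hb]; exists (maxn K0 K1).+1 => -[//|K].
rewrite ltnS geq_max => /andP[KK0 KK1]; rewrite -(ha K) // -(hb K) //.
rewrite /hol expnS mul2n -addnn holonomy_cat.
have dbl l : 2 * grid K.+1 l = grid K l.
  by rewrite /grid exprS; have := pow2_gt0 K => ?; field; rewrite gt_eqF.
congr (_ * _)%g; apply: eq_holonomy => l lN; rewrite /sample /concat; congr
  gparts.
  have : grid K l <= 1 by have /itv01P/andP[] := grid_itv lN.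
  by rewrite -dbl => le1; rewrite ifT ?dbl //; lra.
have e : grid K (2 ^ K + l) = 1 + grid K l.
  by rewrite -(grid1 K) /grid natrD mulrDl.
(* At the junction [concat] takes the end of [a], which is the start of [b]. *)
have [g0|g0] := leP (grid K.+1 (2 ^ K + l)) 2^-1; last first.
  by rewrite dbl e; congr b; ring.
have /itv01P/andP[ge0 _] := grid_itv lN.
have z : grid K l = 0 by move: (dbl (2 ^ K + l)%N); rewrite e; lra.
by rewrite dbl e z addr0 ab.
Qed.

Lemma adherent_twist w (z z' : conf) :
  adherent z z' -> adherent (twist w.1 w.2 z) (twist w.1 w.2 z').
Proof.
move=> [hr hi]; have [er ei] := parts_twist w z; have [er' ei'] := parts_twist w
  z'.
by split; rewrite ?er ?ei ?er' ?ei'; exact: sign_extends_act.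
Qed.

(** As [generify] need not commute with w, the twisted samples and the samples of the twisted path
    may differ. A ladder compares them, and its end rungs are trivial because the end points are
    generic. *)
Lemma has_holonomy_twist w a h : invariant R w -> orbit_path a ->
  generic (repart (a 0)) -> generic (impart (a 0)) ->
  generic (repart (a 1)) -> generic (impart (a 1)) ->
  has_holonomy a h -> has_holonomy (twist w.1 w.2 \o a) h.
Proof.
move=> iw pa r0 i0 r1 i1 [K1 ha].
have [K0 hK0] := fine_grid_path pa.
exists (maxn K0 K1) => K; rewrite geq_max => /andP[KK0 KK1]; rewrite -(ha K) //.
have fix_end t : generic (repart (a t)) -> generic (impart (a t)) ->
    gparts (twist w.1 w.2 (a t)) = act2 w (gparts (a t)).
  move=> gr gi; rewrite (gparts_generic gr gi) -parts_twist.
  have [er ei] := parts_twist w (a t).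
  by apply: gparts_generic; rewrite ?er ?ei; exact: generic_act.
pose q k := act2 w (sample a K k).
have hq : holonomy q (2 ^ K) = hol a K.
  rewrite /hol; elim: (2 ^ K)%N => //= N ->; congr (_ * _)%g.
  have [g _ _] := generifyP (repart (a (grid K N))).
  have [g' _ _] := generifyP (repart (a (grid K N.+1))).
  exact: step_act.
rewrite -hq.
have := @holonomy_square R m (sample (twist w.1 w.2 \o a) K) q (2 ^ K).
rewrite [sample _ K 0]/sample [sample _ K (2 ^ K)]/sample grid0 grid1 /= /q.
rewrite [sample _ K 0]/sample [sample _ K (2 ^ K)]/sample grid0 grid1.
rewrite !fix_end // !stepxx mulg1 mul1g; apply=> k kN.
have [|z [nz hz]] := hK0 K KK0 (grid K k); first exact/grid_itv/ltnW.
have ad : adherent z (a (grid K k)).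
  by apply: hz; [exact/grid_itv/ltnW|rewrite subrr normr0 pow2_inv_ge0].
have ad1 : adherent z (a (grid K k.+1)).
  apply: hz; first exact: grid_itv.
  by rewrite gridS addrC addKr ger0_norm // pow2_inv_ge0.
exists (parts (twist w.1 w.2 z)); split.
  exact/orbit_conf_nondegenerate/orbit_conf_twist.
rewrite /sample /=; split.
- exact/star_gparts/adherent_twist.
- exact/star_gparts/adherent_twist.
- by rewrite parts_twist; exact/star_act/star_gparts.
- by rewrite parts_twist; exact/star_act/star_gparts.
Qed.

(** On a grid fine enough for the homotopy, neighbouring rows form a ladder of squares in stars; its
    end rungs are trivial because the homotopy fixes the end points. *)
Lemma has_holonomy_homotopic a b h :
  homotopic a b -> has_holonomy a h -> has_holonomy b h.
Proof.
move=> [H [cH FH Hab He]] [K1 ha].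
have [K0 hK0] := fine_grid cH FH.
exists (maxn K0 K1) => K; rewrite geq_max => /andP[KK0 KK1]; rewrite -(ha K) //.
pose row u t := H (t, u).
have I0' := @I0 R; have I1' := @I1 R.
have hrow j : (j <= 2 ^ K)%N -> hol (row (grid K j)) K = hol (row 0) K.
  elim: j => [|j IH] jN; first by rewrite grid0.
  rewrite -IH 1?ltnW //.
  have gj := grid_itv (ltnW jN); have gj1 := grid_itv jN.
  have := @holonomy_square R m (sample (row (grid K j)) K) (sample (row (grid K
    j.+1)) K) (2 ^ K).
  rewrite /sample grid0 grid1 /row.
  have [-> ->] := He _ gj; have [-> ->] := He _ gj1.
  rewrite !stepxx mulg1 mul1g => h1; apply/esym/h1 => k kN.
  have gk := grid_itv (ltnW kN); have gk1 := grid_itv kN.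
  have [|z [nz hz]] := hK0 K KK0 (grid K k, grid K j); first by split.
  exists (parts z); split; first exact/orbit_conf_nondegenerate.
  have n0 (x : R) : `|x - x| <= 2 ^- K by rewrite subrr normr0 pow2_inv_ge0.
  have n1 l : `|grid K l.+1 - grid K l| <= 2 ^- K.
    by rewrite gridS addrC addKr ger0_norm // pow2_inv_ge0.
  split; apply: star_gparts.
  - by apply: (hz (grid K k, grid K j)) => //=.
  - by apply: (hz (grid K k.+1, grid K j)) => //=.
  - by apply: (hz (grid K k, grid K j.+1)) => //=.
  - by apply: (hz (grid K k.+1, grid K j.+1)) => //=.
have e0 : hol (row 0) K = hol a K.
  apply: eq_holonomy => k kN; rewrite /sample /row.
  by have [-> _] := Hab _ (grid_itv kN).
have e1 : hol (row 1) K = hol b K.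
  apply: eq_holonomy => k kN; rewrite /sample /row.
  by have [_ ->] := Hab _ (grid_itv kN).
by rewrite -e0 -e1 -(grid1 K) hrow.
Qed.

Lemma has_holonomy_star (z : conf) a : orbit_conf z ->
  (forall t, I t -> adherent z (a t)) ->
  has_holonomy a (step (gparts (a 0)) (gparts (a 1))).
Proof.
move=> Fz h; exists 0%N => K _; rewrite /hol (holonomy_star (z := parts z)).
- by rewrite /sample grid0 grid1.
- exact/orbit_conf_nondegenerate.
- by move=> k kN; apply/star_gparts/h/grid_itv.
Qed.

End PathHolonomy.

(** * Braids lifting signed permutations *)

Section LiftedBraids.
Variables (R : realType) (m : nat).
Local Notation n := m.+2.
Local Notation V := 'rV[R]_n.
Local Notation gen := (brD_gen n).
Local Notation signed_perm := ({ffun 'I_n -> 'Z_2} * 'S_n)%type.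
Local Notation C := (R[i]^o).
Local Notation conf := 'rV[C]_n.
Local Notation I := [set` `[(0 : R), (1 : R)]].

Definition line (p q : V * V) (t : R) : conf :=
  conf_of ((1 - t) *: p.1 + t *: q.1, (1 - t) *: p.2 + t *: q.2).

Lemma line0 p q : line p q 0 = conf_of p.
Proof. by rewrite /line subr0 !scale0r !scale1r !addr0; case: p. Qed.

Lemma line1 p q : line p q 1 = conf_of q.
Proof. by rewrite /line subrr !scale0r !scale1r !add0r; case: q. Qed.

Lemma parts_line p q t : parts (line p q t) =
  ((1 - t) *: p.1 + t *: q.1, (1 - t) *: p.2 + t *: q.2).
Proof. exact: parts_conf_of. Qed.

Lemma root_comb (i j : 'I_n) b (x y : V) t :
  root i j b ((1 - t) *: x + t *: y) = (1 - t) * root i j b x + t * root i j b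
    y.
Proof. by rewrite /root !mxE; ring. Qed.

Lemma comb_gt0 (a c t : R) : I t -> 0 < a -> 0 < c -> 0 < (1 - t) * a + t * c.
Proof.
move=> /itv01P/andP[t0 t1] a0 c0.
have [->|nt] := eqVneq t 0; first by lra.
have tp : 0 < t by rewrite lt_neqAle eq_sym nt.
by rewrite ltr_wpDl // ?mulr_gt0 // mulr_ge0 ?subr_ge0 // ltW.
Qed.

Lemma conf_of_continuous (T : topologicalType) (x y : T -> V) :
  (forall i, continuous (fun s => x s ord0 i)) ->
  (forall i, continuous (fun s => y s ord0 i)) ->
  continuous (fun s => conf_of (x s, y s)).
Proof.
move=> cx cy; apply: conf_continuous => i.
rewrite (_ : (fun s => _) = (fun s => x s ord0 i +i* y s ord0 i : C)).
  exact: continuous_complex.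
by apply/funext => s; rewrite mxE.
Qed.

Lemma comb_continuous (T : topologicalType) (x y : T -> V) (f : T -> R) :
  continuous f ->
  (forall i, continuous (fun s => x s ord0 i)) ->
  (forall i, continuous (fun s => y s ord0 i)) ->
  forall i, continuous (fun s => ((1 - f s) *: x s + f s *: y s) ord0 i).
Proof.
move=> cf cx cy i.
rewrite (_ : (fun s => _) =
  (fun s => (1 - f s) * x s ord0 i + f s * y s ord0 i)).
  move=> s; apply: cvgD; apply: cvgM; [|exact: cx|exact: cf|exact: cy].
  by apply: cvgB; [exact: cvg_cst|exact: cf].
by apply/funext => s; rewrite !mxE.
Qed.

Lemma line_continuous p q : continuous (line p q).
Proof.
apply: conf_of_continuous; apply: comb_continuous => [s|i s|i s];
  (exact: cvg_id || exact: cvg_cst).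
Qed.

(** * Straight-line homotopies *)

Definition constant_sign (i j : 'I_n) (b : bool) (a c : R -> conf) : Prop :=
  (exists s, forall t, I t -> 0 < s * root i j b (repart (a t)) /\
                              0 < s * root i j b (repart (c t))) \/
  (exists s, forall t, I t -> 0 < s * root i j b (impart (a t)) /\
                              0 < s * root i j b (impart (c t))).

(** A root of one constant sign on the real, or on the imaginary, parts of both paths keeps that
    sign on the segments joining them, so the linear homotopy stays among orbit configurations. *)
Lemma homotopic_straight a c : orbit_path a -> orbit_path c ->
  a 0 = c 0 -> a 1 = c 1 ->
  (forall i j b, i != j -> constant_sign i j b a c) -> homotopic a c.
Proof.
move=> [ca Fa] [cc Fc] ac0 ac1 cs.
pose H (x : R * R) : conf := line (parts (a x.1)) (parts (c x.1)) x.2.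
have coord (f : R -> conf) : {within I, continuous f} ->
    (forall i, {within I `*` I, continuous (fun x => repart (f x.1) ord0 i)}) /\
    (forall i, {within I `*` I, continuous (fun x => impart (f x.1) ord0 i)}).
  move=> cf.
  have cf1 : {within I `*` I, continuous (f \o fst)}.
    apply: (within_comp _ _ cf); last by move=> x [].
    by apply: continuous_subspaceT => x; exact: cvg_fst.
  have cg i := @conf_coord_continuous R n (subspace (I `*` I)) (f \o fst) i cf1.
  split=> i.
    rewrite (_ : (fun x => _) =
      (fun z : C => complex.Re z) \o (fun x => f x.1 ord0 i : C)).
      by move=> x; exact: (continuous_comp (cg i x) (@continuous_re R _)).
    by apply/funext => x /=; rewrite mxE.
  rewrite (_ : (fun x => _) =
    (fun z : C => complex.Im z) \o (fun x => f x.1 ord0 i : C)).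
    by move=> x; exact: (continuous_comp (cg i x) (@continuous_im R _)).
  by apply/funext => x /=; rewrite mxE.
have [car cai] := coord a ca; have [ccr cci] := coord c cc.
have c2 : {within I `*` I, continuous (fun x : R * R => x.2)}.
  by apply: continuous_subspaceT => x; exact: cvg_snd.
exists H; split.
- apply: (@conf_of_continuous (subspace (I `*` I))).
    exact: (@comb_continuous (subspace (I `*` I))).
  exact: (@comb_continuous (subspace (I `*` I))).
- move=> t u It Iu; apply/orbit_conf_nondegenerate => i j b ij.
  rewrite /H parts_line /= !root_comb.
  have [[s hs]|[s hs]] := cs i j b ij; [left|right]; have [h1 h2] := hs t It;
    have := comb_gt0 Iu h1 h2; rewrite !(mulrCA _ s) -mulrDr;
    exact: mul_gt0_neq0.
- by move=> t It; rewrite /H /= line0 line1 !conf_of_parts.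
- move=> u Iu; rewrite /H /= -ac0 -ac1.
  have same (p : V * V) : line p p u = conf_of p.
    rewrite /line -!scalerDl subrK !scale1r; by case: p.
  by rewrite !same !conf_of_parts.
Qed.

Lemma concat_prop (Q : conf -> Prop) (a c : R -> conf) :
  (forall t, I t -> Q (a t)) -> (forall t, I t -> Q (c t)) ->
  forall t, I t -> Q (concat a c t).
Proof.
move=> Qa Qc t /itv01P/andP[t0 t1]; rewrite /concat; case: leP => ?.
  by apply/Qa/itv01P/andP; split; lra.
by apply/Qc/itv01P/andP; split; lra.
Qed.

Lemma concat_assoc (a b c : R -> conf) : orbit_path a -> orbit_path b ->
    orbit_path c ->
  a 1 = b 0 -> b 1 = c 0 ->
  homotopic (concat (concat a b) c) (concat a (concat b c)).
Proof.
move=> pa pb pc ab bc.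
(* The reparametrization is concave, hence the minimum of its affine pieces, of slopes 2, 1 and 1/2,
   which meet at 1/4 and 1/2. *)
pose f t : R := Num.min (2 * t) (Num.min (t + 4^-1) (2^-1 * t + 2^-1)).
have fI t : I t -> I (f t).
  move=> /itv01P/andP[? ?]; apply/itv01P; rewrite /f.
  by rewrite !le_min !ge_min; apply/andP; split;
    [apply/and3P; split; lra|apply/orP; right; apply/orP; right; lra].
have cf : continuous f.
  move=> t; apply: continuous_min; first exact: mul2_continuous.
  apply: continuous_min.
    by apply: cvgD; [exact: cvg_id|exact: cvg_cst].
  apply: cvgD; last exact: cvg_cst.
  by apply: cvgM; [exact: cvg_cst|exact: cvg_id].
have pbc : orbit_path (concat b c) by exact: orbit_path_concat.
have pabc : orbit_path (concat a (concat b c)).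
  by apply: orbit_path_concat => //; rewrite concat0.
have pabc' : orbit_path (concat (concat a b) c).
  by apply: orbit_path_concat => //; [exact: orbit_path_concat|rewrite concat1].
apply: (homotopic_trans (b := concat a (concat b c) \o f)).
  apply: homotopic_eq => // t /itv01P/andP[? ?]; rewrite /= /concat /=.
  have [t2|t2] := leP t 2^-1; last first.
    rewrite (_ : f t = 2^-1 * t + 2^-1); last first.
      by rewrite /f !(min_idPr _) //; lra.
    rewrite ifF; last by apply/negbTE; rewrite -ltNge; lra.
    rewrite ifF; last by apply/negbTE; rewrite -ltNge; lra.
    by congr (c _); lra.
  have [t4|t4] := leP (2 * t) 2^-1.
    rewrite (_ : f t = 2 * t); last first.
      by rewrite /f (min_idPl _) // le_min; apply/andP; split; lra.
    by rewrite ifT.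
  rewrite (_ : f t = t + 4^-1); last first.
    by rewrite /f (min_idPr _) ?(min_idPl _) //; lra.
  rewrite ifF; last by apply/negbTE; rewrite -ltNge; lra.
  rewrite ifT; last by lra.
  by congr (b _); lra.
have f0 : f 0 = 0.
  by rewrite /f (min_idPl _) ?mulr0 // le_min; apply/andP; split; lra.
have f1 : f 1 = 1.
  by rewrite /f !(min_idPr _); lra.
apply: (homotopic_reparam (g := id)) => //.
by move=> ?; exact: cvg_id.
Qed.

Lemma hline_orbit_path (x x' y : V) : generic y -> orbit_path (line (x, y) (x',
    y)).
Proof.
move=> gy; split=> [|t It]; first exact/continuous_subspaceT/line_continuous.
apply/orbit_conf_nondegenerate => i j b ij; right.
by rewrite parts_line /= root_comb -mulrDl subrK mul1r gy.
Qed.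

Lemma vline_orbit_path (x y y' : V) : generic x -> orbit_path (line (x, y) (x,
    y')).
Proof.
move=> gx; split=> [|t It]; first exact/continuous_subspaceT/line_continuous.
apply/orbit_conf_nondegenerate => i j b ij; left.
by rewrite parts_line /= root_comb -mulrDl subrK mul1r gx.
Qed.

Lemma repart_line_gt0 s i j b (p q : V * V) :
  0 < s * root i j b p.1 -> 0 < s * root i j b q.1 ->
  forall t, I t -> 0 < s * root i j b (repart (line p q t)).
Proof.
move=> hp hq t It; have [-> _] := parts_line p q t.
by rewrite root_comb mulrDr !(mulrCA s) comb_gt0.
Qed.

Lemma impart_line_gt0 s i j b (p q : V * V) :
  0 < s * root i j b p.2 -> 0 < s * root i j b q.2 ->
  forall t, I t -> 0 < s * root i j b (impart (line p q t)).
Proof.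
move=> hp hq t It; have [_ ->] := parts_line p q t.
by rewrite root_comb mulrDr !(mulrCA s) comb_gt0.
Qed.

Lemma concat_repart_gt0 s i j b (a c : R -> conf) :
  (forall t, I t -> 0 < s * root i j b (repart (a t))) ->
  (forall t, I t -> 0 < s * root i j b (repart (c t))) ->
  forall t, I t -> 0 < s * root i j b (repart (concat a c t)).
Proof. exact: (@concat_prop (fun z => 0 < s * root i j b (repart z))). Qed.

Lemma concat_impart_gt0 s i j b (a c : R -> conf) :
  (forall t, I t -> 0 < s * root i j b (impart (a t))) ->
  (forall t, I t -> 0 < s * root i j b (impart (c t))) ->
  forall t, I t -> 0 < s * root i j b (impart (concat a c t)).
Proof. exact: (@concat_prop (fun z => 0 < s * root i j b (impart z))). Qed.

Lemma hline_concat (x x' x'' y : V) : generic y ->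
  homotopic (concat (line (x, y) (x', y)) (line (x', y) (x'', y)))
            (line (x, y) (x'', y)).
Proof.
move=> gy; apply: homotopic_straight.
- by apply: orbit_path_concat; rewrite ?line1 ?line0 //; exact:
    hline_orbit_path.
- exact: hline_orbit_path.
- by rewrite concat0 !line0.
- by rewrite concat1 !line1.
move=> i j b ij; have yy := mulss_gt0 (gy i j b ij).
right; exists (root i j b y) => t It; split; last exact: impart_line_gt0.
by apply: concat_impart_gt0 => //; exact: impart_line_gt0.
Qed.

Lemma vline_concat (x y y' y'' : V) : generic x ->
  homotopic (concat (line (x, y) (x, y')) (line (x, y') (x, y'')))
            (line (x, y) (x, y'')).
Proof.
move=> gx; apply: homotopic_straight.
- by apply: orbit_path_concat; rewrite ?line1 ?line0 //; exact:
    vline_orbit_path.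
- exact: vline_orbit_path.
- by rewrite concat0 !line0.
- by rewrite concat1 !line1.
move=> i j b ij; have xx := mulss_gt0 (gx i j b ij).
left; exists (root i j b x) => t It; split; last exact: repart_line_gt0.
by apply: concat_repart_gt0 => //; exact: repart_line_gt0.
Qed.

(** The two ways around a rectangle are homotopic when no root changes sign along both of its
    sides. *)
Lemma line_swap (x x' y y' : V) :
  generic x -> generic x' -> generic y -> generic y' ->
  (forall i j b, i != j ->
    0 < root i j b x * root i j b x' \/ 0 < root i j b y * root i j b y') ->
  homotopic (concat (line (x, y) (x, y')) (line (x, y') (x', y')))
            (concat (line (x, y) (x', y)) (line (x', y) (x', y'))).
Proof.
move=> gx gx' gy gy' h; apply: homotopic_straight.
- apply: orbit_path_concat; rewrite ?line1 ?line0 //.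
    exact: vline_orbit_path.
  exact: hline_orbit_path.
- apply: orbit_path_concat; rewrite ?line1 ?line0 //.
    exact: hline_orbit_path.
  exact: vline_orbit_path.
- by rewrite !concat0 !line0.
- by rewrite !concat1 !line1.
move=> i j b ij; have xx := mulss_gt0 (gx i j b ij).
have yy := mulss_gt0 (gy i j b ij).
have [k|k] := h i j b ij.
  left; exists (root i j b x) => t It.
  by split; apply: concat_repart_gt0 => //; exact: repart_line_gt0.
right; exists (root i j b y) => t It.
by split; apply: concat_impart_gt0 => //; exact: impart_line_gt0.
Qed.

(** * Canonical lifts of signed permutations *)

Local Notation b0 := (base R m).

Lemma generic_base : generic b0.
Proof. exact/chamber_generic/chamber_base. Qed.

Lemma base_confE : base_conf R n = conf_of (b0, b0).
Proof. by apply/rv_eq => i; rewrite !mxE. Qed.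

Definition lift_path (v : V) : R -> conf :=
  concat (line (b0, b0) (v, b0)) (line (v, b0) (v, v)).

Lemma lift_path_orbit_path v : generic v -> orbit_path (lift_path v).
Proof.
move=> gv; apply: orbit_path_concat; last by rewrite line0 line1.
  exact/hline_orbit_path/generic_base.
exact: vline_orbit_path.
Qed.

Lemma lift_path0 v : lift_path v 0 = base_conf R n.
Proof. by rewrite /lift_path concat0 line0 base_confE. Qed.

Lemma lift_path1 w : lift_path (act w b0) 1 = twist w.1 w.2 (base_conf R n).
Proof. by rewrite /lift_path concat1 line1 base_confE -conf_of_act2. Qed.

Lemma generic_act_base w : generic (act w b0).
Proof. exact/generic_act/generic_base. Qed.

Lemma lift_path_base_orbit w : base_orbit (lift_path (act w b0) 1).
Proof. by exists w.1, w.2; rewrite lift_path1. Qed.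

Definition lift_braid (w : signed_perm) : braid_path R n :=
  BraidPath (lift_path_orbit_path (generic_act_base w)) (lift_path0 _)
    (lift_path_base_orbit w).

Lemma end_lift_braid w : end_sign (lift_braid w) = w.1 /\ end_perm (lift_braid
    w) = w.2.
Proof. exact/end_uniq/lift_path1. Qed.

Lemma twist_line w p q t :
  twist w.1 w.2 (line p q t) = line (act2 w p) (act2 w q) t.
Proof.
rewrite /line -conf_of_act2; congr (conf_of (_, _));
  by apply/rv_eq => i; rewrite !mxE; ring.
Qed.

Lemma twist_concat (w : signed_perm) (a c : R -> conf) t :
  twist w.1 w.2 (concat a c t) = concat (twist w.1 w.2 \o a) (twist w.1 w.2 \o
    c) t.
Proof. by rewrite /concat; case: ifP. Qed.

(* Both paths first move the real parts, then the imaginary ones; exchanging the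
   two middle moves is possible since the walls they may meet are distinct. *)
Lemma lift_braid_mul w s : 0 < simple s (act (spinv w) b0) ->
  homotopic (braid_mul (lift_braid w) (lift_braid (refl s)))
            (lift_braid (spmul w (refl s))).
Proof.
move=> pos; have [es ep] := end_lift_braid w.
rewrite /= /braid_mul_fun es ep /= act_spmul.
set x := act w b0; set x' := act w (act (refl s) b0).
have gx : generic x by exact: generic_act_base.
have gx' : generic x' by exact/generic_act/generic_act_base.
have gb := generic_base.
have twE t : (twist w.1 w.2 \o lift_path (act (refl s) b0)) t =
    concat (line (x, x) (x', x)) (line (x', x) (x', x')) t.
  rewrite /= twist_concat /concat; case: ifP => _; exact: twist_line.
have hp y z z' (gy : generic y) := @hline_orbit_path z z' y gy.
have vp y z z' (gy : generic y) := @vline_orbit_path y z z' gy.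
apply: (homotopic_trans (b := concat (lift_path x)
    (concat (line (x, x) (x', x)) (line (x', x) (x', x'))))).
  apply: homotopic_eq.
    have := braid_mul_orbit_path (lift_braid w) (lift_braid (refl s)).
    by rewrite /braid_mul_fun es ep.
  by move=> t _; rewrite /concat; case: ifP => // _; exact: twE.
(* The product runs through h1, v1, h2, v2. Exchanging v1 and h2 gives h1, h2', v1', v2, where the
   two real moves merge, and so do the two imaginary moves. *)
set h1 := line (b0, b0) (x, b0); set v1 := line (x, b0) (x, x).
set h2 := line (x, x) (x', x); set v2 := line (x', x) (x', x').
pose h2' := line (x, b0) (x', b0); pose v1' := line (x', b0) (x', x).
have [ph1 ph2 ph2'] : [/\ orbit_path h1, orbit_path h2 & orbit_path h2'].
  by split; exact: hp.
have [pv1 pv2 pv1'] : [/\ orbit_path v1, orbit_path v2 & orbit_path v1'].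
  by split; exact: vp.
have ends (p q r : V * V) : line p q 1 = line q r 0 by rewrite line0 line1.
have refl' a : orbit_path a -> homotopic a a by move=> pa; exact: homotopic_eq.
have pc := @orbit_path_concat R n.
have e12 : h1 1 = v1 0 by exact: ends.
have e23 : v1 1 = h2 0 by exact: ends.
have e34 : h2 1 = v2 0 by exact: ends.
have e12' : h1 1 = h2' 0 by exact: ends.
have e23' : h2' 1 = v1' 0 by exact: ends.
have e34' : v1' 1 = v2 0 by exact: ends.
have p12 := pc _ _ ph2 pv2 e34.
apply: (homotopic_trans (b := concat h1 (concat v1 (concat h2 v2)))).
  by apply: concat_assoc; rewrite ?concat0.
apply: (homotopic_trans (b := concat h1 (concat (concat v1 h2) v2))).
  apply: homotopic_concat; [exact: refl'| |by rewrite concat0].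
  by apply: homotopic_sym; apply: concat_assoc.
apply: (homotopic_trans (b := concat h1 (concat (concat h2' v1') v2))).
  apply: homotopic_concat; [exact: refl'| |by rewrite !concat0].
  apply: homotopic_concat; [|exact: refl'|by rewrite concat1].
  apply: line_swap => // i j b ij.
  (* Only the image under w of the mirror of s separates x from x', and by [pos] it does not
     separate the base point from x. *)
  have [b' e] := root_act R w i j b.
  have ij' : w.2 i != w.2 j by rewrite (inj_eq perm_inj).
  have [k|[c k]] := chamber_refl s b' (@chamber_base R m) ij'.
    by left; rewrite !e mulrACA sign_sqr mul1r.
  right; rewrite -{1}(act_spinvK w b0) !e !k mulrACA sign_sqr mul1r.
  by rewrite mulrACA sign_sqr mul1r mulr_gt0 // chamber_base.
apply: (homotopic_trans (b := concat h1 (concat h2' (concat v1' v2)))).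
  apply: homotopic_concat; [exact: refl'| |by rewrite !concat0].
  by apply: concat_assoc.
have pv : orbit_path (concat v1' v2) by apply: pc.
apply: (homotopic_trans (b := concat (concat h1 h2') (concat v1' v2))).
  by apply: homotopic_sym; apply: concat_assoc => //; rewrite concat0.
apply: homotopic_concat; [exact: hline_concat|exact: vline_concat|].
by rewrite concat1 concat0.
Qed.

End LiftedBraids.

(** * The embedding *)

Section Embedding.
Variables (R : realType) (m : nat).
Local Notation n := m.+2.
Local Notation V := 'rV[R]_n.
Local Notation gen := (brD_gen n).
Local Notation signed_perm := ({ffun 'I_n -> 'Z_2} * 'S_n)%type.
Local Notation C := (R[i]^o).
Local Notation conf := 'rV[C]_n.
Local Notation I := [set` `[(0 : R), (1 : R)]].

Local Notation OB := (orbit_braid_group R n).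
Local Notation b0 := (base R m).

Definition braid_class (a : braid_path R n) : OB := \pi_(orbit_braid_group R n)
    a.

Lemma braid_class_eq a c : braid_class a = braid_class c <-> homotopic a c.
Proof. exact: obg_piP. Qed.

Lemma braid_classM a c :
  (braid_class a * braid_class c)%g = braid_class (braid_mul a c).
Proof. exact: obg_mulE. Qed.

Lemma lift_class_mul w s : 0 < simple s (act (spinv w) b0) ->
  (braid_class (lift_braid R w) * braid_class (lift_braid R (refl s)))%g =
  braid_class (lift_braid R (spmul w (refl s))).
Proof. by move=> h; rewrite braid_classM; exact/braid_class_eq/lift_braid_mul.
  Qed.

(** The lifted path depends on w only through the image of the base point, so relations between
    signed permutations need only be checked on vectors. *)
Lemma lift_class_act w w' : act w b0 = act w' b0 ->
  braid_class (lift_braid R w) = braid_class (lift_braid R w').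
Proof.
move=> e; apply/braid_class_eq/homotopic_eq.
  exact: braid_path_orbit_path.
by move=> t _; rewrite /= e.
Qed.

Definition refl_class (s : gen) : OB := braid_class (lift_braid R (refl s)).

Lemma act_spinv_refl s (v : V) : act (spinv (refl s)) v = act (refl s) v.
Proof. by rewrite -{1}(act_reflK s v) act_spinvVK. Qed.

Lemma act_spinv_refl2 s t (v : V) :
  act (spinv (spmul (refl s) (refl t))) v = act (refl t) (act (refl s) v).
Proof.
have e : act (spmul (refl s) (refl t)) (act (refl t) (act (refl s) v)) = v.
  by rewrite act_spmul !act_reflK.
by rewrite -{1}e act_spinvVK.
Qed.

(** Both sides are reduced words for the same element, and lifting is multiplicative along reduced
    words; the positivity conditions say that the length grows. *)
Lemma refl_class_braid s t : adjacent s t ->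
  (refl_class s * refl_class t * refl_class s =
   refl_class t * refl_class s * refl_class t)%g.
Proof.
have half s' t' : adjacent s' t' ->
    (refl_class s' * refl_class t' * refl_class s')%g =
    braid_class (lift_braid R (spmul (spmul (refl s') (refl t')) (refl s'))).
  move=> ad; have ad' : adjacent t' s' by rewrite adjacent_sym.
  have [ps pt] := (@chamber_base R m s', @chamber_base R m t').
  rewrite /refl_class lift_class_mul ?lift_class_mul //.
    rewrite act_spinv_refl2 simple_refl_braid // simple_refl.
    by rewrite simple_refl_braid //; lra.
  by rewrite act_spinv_refl simple_refl_braid //; lra.
move=> ad; rewrite !half // 1?adjacent_sym //.
by apply: lift_class_act; rewrite !act_spmul act_refl_braid.
Qed.

Lemma refl_class_comm s t : s != t -> ~~ adjacent s t ->
  (refl_class s * refl_class t = refl_class t * refl_class s)%g.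
Proof.
move=> st ad; have ad' : ~~ adjacent t s by rewrite adjacent_sym.
have [ps pt] := (@chamber_base R m s, @chamber_base R m t).
rewrite /refl_class !lift_class_mul.
- by apply: lift_class_act; rewrite !act_spmul act_refl_comm.
- by rewrite act_spinv_refl simple_refl_comm // eq_sym.
- by rewrite act_spinv_refl simple_refl_comm.
Qed.

(** * The homomorphism from the Artin group *)

Definition letter_class (x : gen * bool) : OB :=
  if x.2 then refl_class x.1 else (refl_class x.1)^-1%g.

Definition word_class (u : word gen) : OB :=
  foldr (fun x y => letter_class x * y)%g 1%g u.

Lemma word_class_cat u v : word_class (u ++ v) = (word_class u * word_class
    v)%g.
Proof. by elim: u => [|x u IH] /=; rewrite ?mul1g // IH mulgA. Qed.

Lemma word_class_eq u v :
  pres_eq (@brD_rel n) u v -> word_class u = word_class v.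
Proof.
elim=> {u v} [u v []| x b | u u' v v' _ IHu _ IHv | u | u v _ -> | u v w _ -> _
  ->] //.
- move=> i j e; have ad : adjacent (Some i : gen) (Some j) by rewrite /adjacent
    /= e eqxx orbT.
  by have := refl_class_braid ad; rewrite /word_class /letter_class /= !mulg1
    !mulgA.
- move=> i e; have ad : adjacent (None : gen) (Some i).
    by move: e => [e]; rewrite /adjacent /= e.
  by have := refl_class_braid ad; rewrite /word_class /letter_class /= !mulg1
    !mulgA.
- move=> i e; have ad : ~~ adjacent (None : gen) (Some i).
    rewrite /adjacent /=; apply/negP => /eqP e1; apply: e; by rewrite e1.
  by have := refl_class_comm (isT : (None : gen) != Some i) ad;
    rewrite /word_class /letter_class /= !mulg1.
- move=> i j /= e; have ij : (Some i : gen) != Some j.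
    by apply/eqP => -[eij]; rewrite eij in e; lia.
  have ad : ~~ adjacent (Some i : gen) (Some j) by rewrite /adjacent /=; lia.
  by have := refl_class_comm ij ad; rewrite /word_class /letter_class /= !mulg1.
- by rewrite /word_class /letter_class /=; case: b; rewrite /= mulg1 ?mulgV
    ?mulVg.
- by rewrite !word_class_cat IHu IHv.
Qed.

Definition brD_class (x : BrD n) : OB := word_class (repr x).

Lemma brD_class_word u : brD_class (word_braid u) = word_class u.
Proof. exact/word_class_eq/pres_repr. Qed.

Lemma word_braid_repr (x : BrD n) : word_braid (repr x) = x.
Proof. exact: reprK. Qed.

Lemma brD_classM : {morph brD_class : x y / (x * y)%g}.
Proof.
move=> x y; rewrite -(word_braid_repr x) -(word_braid_repr y) brD_mulE.
by rewrite !brD_class_word word_class_cat.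
Qed.

Lemma brD_class1 : brD_class 1%g = 1%g.
Proof. exact: (brD_class_word [::]). Qed.

(** A relation, as the end element of the representative is required to leave the potential
    invariant; this makes the holonomy multiplicative. *)
Definition class_holonomy (x : OB) (h : BrD n) : Prop := exists a,
  [/\ x = braid_class a, has_holonomy a h & invariant R (end_sign a, end_perm
    a)].

Lemma class_holonomy_uniq x h h' :
  class_holonomy x h -> class_holonomy x h' -> h = h'.
Proof.
move=> [a [-> ha _]] [a' [e ha' _]].
apply: has_holonomy_uniq ha _; apply: has_holonomy_homotopic ha'.
exact/homotopic_sym/braid_class_eq.
Qed.

(** In a product the second path is twisted by the end element of the first, and invariance under
    that element preserves its holonomy. *)
Lemma class_holonomyM x y h k : class_holonomy x h -> class_holonomy y k ->
  class_holonomy (x * y)%g (h * k)%g.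
Proof.
move=> [a [-> ha ia]] [c [-> hc ic]]; exists (braid_mul a c); split.
- exact: braid_classM.
- apply: has_holonomy_concat => //; first exact: braid_mul_glue.
  have gb := @generic_base R m.
  have [er ei] := parts_twist (end_sign c, end_perm c) (base_conf R n).
  have [br bi] := parts_conf_of (b0, b0).
  apply: (has_holonomy_twist (w := (end_sign a, end_perm a))) => //;
    rewrite ?braid_path0 ?braid_path_end ?er ?ei /= ?base_confE ?br ?bi //;
    do ?exact: generic_act.
  exact: braid_path_orbit_path.
- by have [-> ->] := end_mul a c; exact: invariant_mul ia ic.
Qed.

Lemma class_holonomy1 : class_holonomy 1%g 1%g.
Proof.
exists (braid_one R n); split=> //; last first.
  by have [-> ->] := end_one R n; exact: invariant_id.
have Fb := @orbit_conf_base R n.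
have := @has_holonomy_star R m (base_conf R n) (braid_one R n) Fb.
rewrite stepxx; apply=> t _; split; exact: sign_extends_refl.
Qed.

(** A root without a sign change keeps its sign on the whole segment, and one that vanishes at the
    midpoint imposes no condition there. *)
Lemma sign_extends_midpoint (x y : V) t : I t ->
  (forall i j b, i != j -> 0 < root i j b x * root i j b y \/
     root i j b (2^-1 *: (x + y)) = 0) ->
  sign_extends (2^-1 *: (x + y)) ((1 - t) *: x + t *: y).
Proof.
move=> It h i j b ij; have [k _|->] := h i j b ij; last by rewrite eqxx.
have -> : 2^-1 *: (x + y) = (1 - 2^-1) *: x + 2^-1 *: y.
  by apply/rv_eq => l; rewrite !mxE; lra.
have I2 : I (2^-1 : R) by apply/itv01P/andP; split; lra.
have nx : root i j b x != 0 by apply: mul_gt0_neq0; rewrite mulrC; exact: k.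
have pos u : I u -> 0 < root i j b x * root i j b ((1 - u) *: x + u *: y).
  by move=> Iu; rewrite root_comb mulrDr !(mulrCA (root i j b x)) comb_gt0 //
    mulss_gt0.
by apply: mul_sign_trans (pos t It); rewrite mulrC pos.
Qed.

(** Each of the two moves stays in the star of the point where it crosses the mirror of s. The real
    move contributes [sigma s], the imaginary one contributes 1. *)
Lemma has_holonomy_refl (s : gen) : has_holonomy (lift_braid R (refl s)) (sigma
    s).
Proof.
have gb := @generic_base R m; have gr := generic_act (refl s) gb.
set r := act (refl s) b0 in gr *; set mid := 2^-1 *: (b0 + r).
have hmid t : I t -> sign_extends mid ((1 - t) *: b0 + t *: r).
  move=> It; apply: sign_extends_midpoint => // i j b ij.
  have [k|[c k]] := chamber_refl s b (@chamber_base R m) ij; [by left|right].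
  (* The midpoint of the base point and its mirror image lies on the mirror. *)
  rewrite k /r act_refl (_ : 2^-1 *: _ = b0 - (2^-1 * simple s b0) *: coroot R
    s).
    by rewrite simpleB simple_coroot eqxx; have := sign_sqr R c; lra.
  by apply/rv_eq => l; rewrite !mxE; lra.
have same (z : V) t : (1 - t) *: z + t *: z = z by rewrite -scalerDl subrK
  scale1r.
have h1 := @has_holonomy_star R m (conf_of (mid, b0)) (line (b0, b0) (r, b0)).
have h2 := @has_holonomy_star R m (conf_of (r, mid)) (line (r, b0) (r, r)).
have gp x y : generic x -> generic y -> gparts (conf_of (x, y)) = (x, y).
  move=> gx gy; have [er ei] := parts_conf_of (x, y).
  by rewrite gparts_generic ?parts_conf_of ?er ?ei.
rewrite -[sigma s]mulg1 /=.
have -> : sigma s = step (gparts (line (b0, b0) (r, b0) 0)) (gparts (line (b0,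
  b0) (r, b0) 1)).
  rewrite line0 line1 !gp // /step /transport /potential /=.
  rewrite -[X in sort_act (sort r) X](act_reflK s) sort_act_refl // -/r.
  rewrite (sort_chamber (@chamber_base R m)) /=.
  by rewrite lift_refl // ?mulKg //; exact: chamber_base.
have -> : (1 : BrD n)%g = step (gparts (line (r, b0) (r, r) 0)) (gparts (line
  (r, b0) (r, r) 1)).
  by rewrite line0 line1 !gp // /step /transport /= mulVg.
apply: has_holonomy_concat; first by rewrite line0 line1.
- apply: h1.
    apply/orbit_conf_nondegenerate; rewrite parts_conf_of => i j b ij.
    by right; exact: gb.
  move=> t It; have [er ei] := parts_line (b0, b0) (r, b0) t.
  have [er' ei'] := parts_conf_of (mid, b0).
  split; rewrite ?er ?ei ?er' ?ei' /=; first exact: hmid.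
  by rewrite same; exact: sign_extends_refl.
- apply: h2.
    apply/orbit_conf_nondegenerate; rewrite parts_conf_of => i j b ij.
    by left; exact: gr.
  move=> t It; have [er ei] := parts_line (r, b0) (r, r) t.
  have [er' ei'] := parts_conf_of (r, mid).
  split; rewrite ?er ?ei ?er' ?ei' /=; last exact: hmid.
  by rewrite same; exact: sign_extends_refl.
Qed.

Lemma class_holonomy_refl (s : gen) : class_holonomy (refl_class s) (sigma s).
Proof.
exists (lift_braid R (refl s)); split=> //; first exact: has_holonomy_refl.
by have [-> ->] := end_lift_braid R (refl s); exact: invariant_refl.
Qed.

(** The inverse path has some holonomy by subdivision; multiplicativity and uniqueness then force
    its value. *)
Lemma class_holonomyV x h : class_holonomy x h -> class_holonomy x^-1%g h^-1%g.
Proof.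
move=> hx; have [a [ex ha ia]] := hx.
have [h' ha'] := has_holonomy_ex (braid_path_orbit_path (braid_inv a)).
have hx' : class_holonomy x^-1%g h'.
  exists (braid_inv a); split=> //.
    apply: (mulgI x); rewrite mulgV ex braid_classM; apply/esym/braid_class_eq.
    exact: braid_mulV_homotopic.
  have [|-> ->] := @end_uniq _ _ (braid_inv a)
    (inv_sign (end_sign a) (end_perm a)) (end_perm a)^-1%g.
    by rewrite /= /braid_inv_fun /= subrr braid_path0.
  exact: (invariant_inv ia).
have := class_holonomyM hx hx'; rewrite mulgV => /class_holonomy_uniq.
by move=> /(_ _ class_holonomy1) /mulg1_eq ->.
Qed.

Lemma class_holonomy_word (u : word gen) : class_holonomy (word_class u)
    (word_braid u).
Proof.
elim: u => [|[s b] u IH]; first exact: class_holonomy1.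
rewrite /= -[word_braid (_ :: u)](brD_mulE [:: (s, b)] u).
apply: class_holonomyM IH; case: b; first exact: class_holonomy_refl.
rewrite (_ : word_braid [:: (s, false)] = (sigma s)^-1%g).
  exact/class_holonomyV/class_holonomy_refl.
by apply/esym; exact: pres_invE.
Qed.

(** The holonomy recovers an element of the Artin group from its class. *)
Lemma brD_class_inj : injective brD_class.
Proof.
move=> x y e; rewrite -(word_braid_repr x) -(word_braid_repr y).
apply: class_holonomy_uniq (class_holonomy_word _) _.
by rewrite -/(brD_class x) e; exact: class_holonomy_word.
Qed.

HB.instance Definition _ := isMultiplicative.Build (BrD n) OB brD_class
  brD_classM.

(** * The image as a subgroup *)

Definition brD_image : {pred OB} := fun x => `[< exists y, brD_class y = x >].

Lemma brD_imageP x : reflect (exists y, brD_class y = x) (x \in brD_image).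
Proof. exact: asboolP. Qed.

Lemma brD_image_mul : mulg_closed brD_image.
Proof.
move=> x y /brD_imageP[x' <-] /brD_imageP[y' <-]; apply/brD_imageP.
by exists (x' * y')%g; exact: brD_classM.
Qed.

Lemma brD_image1 : (1%g : OB) \in brD_image.
Proof. by apply/brD_imageP; exists 1%g; exact: brD_class1. Qed.

Lemma brD_image_inv : invg_closed brD_image.
Proof.
move=> x /brD_imageP[x' <-]; apply/brD_imageP.
by exists x'^-1%g; apply/esym/mulg1_eq; rewrite -brD_classM mulgV brD_class1.
Qed.

HB.instance Definition _ := isMulClosed.Build OB brD_image brD_image_mul.
HB.instance Definition _ := isMul1Closed.Build OB brD_image brD_image1.
HB.instance Definition _ := isInvClosed.Build OB brD_image brD_image_inv.

End Embedding.

(* set_bij says that f is injective with image exactly the subgroup H. *)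
Theorem proposition3p6 (R : realType) (n : nat) (hn : (2 <= n)%N) :
  exists (H : groupClosed (orbit_braid_group R n))
         (f : {multiplicative BrD n -> orbit_braid_group R n}),
    set_bij [set: BrD n] [set x | x \in H] f.
Proof.
case: n hn => [|[|m]] // _.
exists (@brD_image R m : groupClosed _), (@brD_class R m : {multiplicative _ ->
  _}).
split.
- by move=> x _; apply/brD_imageP; exists x.
- by move=> x y _ _; exact: brD_class_inj.
- by move=> x /brD_imageP[y <-]; exists y.
Qed.
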